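(* Let $q\in\mathbb{C}$ with $|q|<1$. Then $$\frac{(q^3,q^3;q^6)_\infty}{(q,q^5;q^6)_\infty}=1+q+\cfrac{q^2-q^3}{1+q^3+\cfrac{q^2+q^4}{1+q^5+\cfrac{q^6-q^9}{1+q^7+\cfrac{q^4+q^8}{1+q^9+\cfrac{q^{10}-q^{15}}{1+q^{11}+\cfrac{q^6+q^{12}}{1+q^{13}+\cdots}}}}}},$$ i.e. the left side equals $b_0+K_{k\ge1}(a_k/b_k)$ with $b_k=1+q^{2k+1}$ for $k\ge0$, and $a_{2n-1}=q^{4n-2}-q^{6n-3}$, $a_{2n}=q^{2n}+q^{4n}$ for $n\ge1$.
   Context: $(x;q)_\infty=\prod_{n\ge0}(1-xq^n)$ and $(x,y;q)_\infty=(x;q)_\infty(y;q)_\infty$. For complex sequences $(a_k)_{k\ge1}$ with all $a_k\neq0$ (so $q\neq0$ here) and $(b_k)_{k\ge0}$, the continued fraction $b_0+K_{k\ge1}(a_k/b_k)=b_0+\cfrac{a_1}{b_1+\cfrac{a_2}{b_2+\cdots}}$ has value $f\in\mathbb{C}\cup\{\infty\}$ if its approximants $b_0+\cfrac{a_1}{b_1+\cdots+\cfrac{a_n}{b_n}}$ converge to $f$ as $n\to\infty$. *)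

(* Defs.v *)
From HB Require Import structures.
From mathcomp Require Import all_boot all_order all_algebra.
From mathcomp Require Import all_classical all_reals all_analysis.
From mathcomp Require Export complex.

Set Implicit Arguments.
Unset Strict Implicit.
Unset Printing Implicit Defensive.

Import Order.TTheory GRing.Theory Num.Theory.
Import numFieldNormedType.Exports.

Local Open Scope classical_set_scope.
Local Open Scope ring_scope.

Section qPochhammer.
Context {K : numFieldType}.
Implicit Types x y q : K.

Definition qpoch x q : K :=
  lim ((\prod_(0 <= i < n) (1 - x * q ^+ i)) @[n --> \oo]).

Definition qpoch2 x y q : K := qpoch x q * qpoch y q.

End qPochhammer.

Section ContinuedFraction.
Context {K : numFieldType}.

(* For K = R[i], the Riemann sphere: [Some z] is the finite point z and [None]
   is infinity. *)
Local Notation sphere := (one_point_compactification K).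

Definition sphere_add (b : K) (w : sphere) : sphere :=
  if w is Some z then Some (b + z) else None.

(* a / w on the sphere, with a / 0 = oo and a / oo = 0; only meaningful for
   a != 0, which is required by [cfrac_value]. *)
Definition sphere_div (a : K) (w : sphere) : sphere :=
  if w is Some z then (if z == 0 then None else Some (a / z)) else Some 0.

(* b_k + a_(k+1) / (b_(k+1) + ... + a_(k+n) / b_(k+n)) *)
Fixpoint cfrac_tail (a b : nat -> K) (k n : nat) : sphere :=
  if n is n'.+1 then
    sphere_add (b k) (sphere_div (a k.+1) (cfrac_tail a b k.+1 n'))
  else Some (b k).

Definition cfrac_approx (a b : nat -> K) (n : nat) : sphere :=
  cfrac_tail a b 0 n.

(* The entry [a 0] is not used: partial numerators are indexed from 1. *)
Definition cfrac_value (a b : nat -> K) (f : sphere) : Prop :=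
  (forall k, (1 <= k)%N -> a k != 0) /\
  (cfrac_approx a b n @[n --> \oo] --> f).

End ContinuedFraction.

(* Main.v *)
Require Import Defs.
From mathcomp Require Import all_boot all_order all_algebra.
From mathcomp Require Import all_classical all_reals all_analysis.
From mathcomp Require Import zify ring.
Import Order.TTheory GRing.Theory Num.Theory.
Import numFieldNormedType.Exports.
Local Open Scope ring_scope.

(** The series
      F_k = sum_n q^(n^2 + 2kn) (-q; q^2)_n /
                  ((q^2; q^2)_n (-q^2; q^2)_(n + floor(k/2)))
    satisfy F_k = b_k F_(k+1) + a_(k+1) F_(k+2), a telescoping identity between
    their terms.  As a_k decreases geometrically and (F_k) is bounded, the
    numerators and the denominators of the approximants, multiplied by F_(n+1),
    tend to F_0 and F_1, so the value is F_0 / F_1.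

    F_0 and F_1 are evaluated by two steps along a finite Bailey chain from the
    unit pairs relative to 1 and q^2.  This gives
      F_0 = C sum_(r in Z) (-1)^r q^(3 r^2),
      F_1 = C sum_(r in Z) (-1)^r q^(3 r^2 + 2 r)
    with C = (-q; q^2)_oo / (q^2; q^2)_oo, and the Jacobi triple product in
    base q^6 turns the sums into (q^3, q^3, q^6; q^6)_oo and
    (q, q^5, q^6; q^6)_oo.  Bilateral sums are folded to unilateral ones,
    pairing r with -r in the first case and with -r - 1 in the second. *)

(** * Triangular numbers in exponents *)

Lemma bin2D m n : 'C(m + n, 2) = ('C(m, 2) + m * n + 'C(n, 2))%N.
Proof.
elim: n => [|j IH]; first by rewrite addn0 bin0n muln0 !addn0.
by rewrite addnS !binS !bin1 IH; lia.
Qed.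

Lemma double_bin2 n : ('C(n, 2) * 2 + n = n * n)%N.
Proof. by elim: n => // n IH; rewrite binS bin1; lia. Qed.

(** * Finite Bailey chain *)

Section FiniteQSeries.
Context {F : fieldType}.
Implicit Types (a b c p rho sigma : F) (alpha beta : nat -> F) (n k r e : nat).

Definition qpochn a p n : F := \prod_(i < n) (1 - a * p ^+ i).

Lemma qpochn0 a p : qpochn a p 0 = 1.
Proof. by rewrite /qpochn big_ord0. Qed.

Lemma qpochnS a p n : qpochn a p n.+1 = qpochn a p n * (1 - a * p ^+ n).
Proof. by rewrite /qpochn big_ord_recr. Qed.

Lemma qpochnSl a p n : qpochn a p n.+1 = (1 - a) * qpochn (a * p) p n.
Proof.
rewrite /qpochn big_ord_recl expr0 mulr1; congr (_ * _).
by apply: eq_bigr => i _; rewrite lift0 exprS mulrA.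
Qed.

Lemma qpochnD a p m n :
  qpochn a p (m + n) = qpochn a p m * qpochn (a * p ^+ m) p n.
Proof.
rewrite /qpochn big_split_ord; congr (_ * _).
by apply: eq_bigr => i _; rewrite /= exprD mulrA.
Qed.

Lemma qpochn_neq0 a p n :
  (forall i, 1 - a * p ^+ i != 0) -> qpochn a p n != 0.
Proof. by move=> ap; apply/prodf_neq0 => i _. Qed.

Section Base.
Variable p : F.
Hypothesis p_root : forall i, 1 - p ^+ i.+1 != 0.

Local Notation qf := (qpochn p p).

Lemma qf_neq0 n : qf n != 0.
Proof. by apply: qpochn_neq0 => i; rewrite -exprS. Qed.

Lemma qfS n : qf n.+1 = qf n * (1 - p ^+ n.+1).
Proof. by rewrite qpochnS -exprS. Qed.

(* Pascal's rule reduces M.+1 to M with b replaced by b * p, because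
   (1 - a b p^k) - b (1 - a p^k) = 1 - b for every k. *)
Lemma chu_vandermonde a b M :
  \sum_(k < M.+1) (- b) ^+ k * p ^+ 'C(k, 2) * qpochn a p k *
     qpochn (a * b * p ^+ k) p (M - k) / (qf k * qf (M - k)) =
  qpochn b p M / qf M.
Proof.
elim: M b => [|M IH] b.
  by rewrite big_ord1 /= !qpochn0 !expr0 !mulr1.
apply: (mulIf (p_root M)).
pose t k := (- (b * p)) ^+ k * p ^+ 'C(k, 2) * qpochn a p k *
  qpochn (a * (b * p) * p ^+ k) p (M - k) / (qf k * qf (M - k)).
transitivity (\sum_(k < M.+1) ((1 - a * b * p ^+ k) * t k
     - b * (1 - a * p ^+ k) * t k)); last first.
  transitivity ((1 - b) * \sum_(k < M.+1) t k).
    by rewrite mulr_sumr; apply: eq_bigr => k _; ring.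
  rewrite /t IH qpochnSl qfS.
  by field; rewrite p_root qf_neq0.
rewrite big_split /= mulr_suml.
pose v k := (- b) ^+ k * p ^+ 'C(k, 2) * qpochn a p k *
  qpochn (a * b * p ^+ k) p (M.+1 - k).
transitivity (\sum_(k < M.+2) (if (k <= M)%N then
    v k * p ^+ k / (qf k * qf (M - k)) else 0)
  + \sum_(k < M.+2) (if (0 < k)%N then
    v k / (qf k.-1 * qf (M.+1 - k)) else 0)).
  rewrite -big_split /=; apply: eq_bigr => -[k /= kM] _.
  rewrite -/(v k).
  case: k kM => [|k] kM /=.
    by rewrite !subn0 !addr0 expr0 mulr1 qfS qpochn0; field; rewrite qf_neq0 p_root.
  rewrite subSS; case: (ltnP k M) => kM'.
    have -> : (M - k = (M - k.+1).+1)%N by lia.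
    rewrite !qfS.
    have -> : p ^+ M.+1 = p ^+ k.+1 * p ^+ (M - k.+1).+1.
      by rewrite -exprD; congr (_ ^+ _); lia.
    by field; rewrite !qf_neq0 !p_root.
  have -> : k = M by lia.
  rewrite subnn qpochn0 add0r qfS; field; by rewrite qf_neq0 p_root.
congr (_ + _).
  rewrite big_ord_recr /= ltnn addr0; apply: eq_bigr => -[k /= kM] _.
  rewrite -ltnS kM /v /t.
  have -> : (M.+1 - k = (M - k).+1)%N by lia.
  rewrite qpochnSl.
  have -> : a * (b * p) * p ^+ k = a * b * p ^+ k * p by ring.
  have -> : (- (b * p)) ^+ k = (- b) ^+ k * p ^+ k by rewrite -exprMn mulNr.
  by ring.
rewrite big_ord_recl /= add0r; apply: eq_bigr => -[k /= kM] _.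
rewrite -[bump 0 k]/k.+1 /= subSS /v /t qpochnS binS bin1 exprD.
have -> : a * (b * p) * p ^+ k = a * b * p ^+ k.+1 by rewrite exprS; ring.
have -> : (- (b * p)) ^+ k = (- b) ^+ k * p ^+ k by rewrite -exprMn mulNr.
by rewrite [(- b) ^+ k.+1]exprS; ring.
Qed.

(** The case a = 0 of [chu_vandermonde], where every symbol (0; p)_n is 1. *)
Lemma qbinomial_theorem b M :
  \sum_(k < M.+1) (- b) ^+ k * p ^+ 'C(k, 2) / (qf k * qf (M - k)) =
  qpochn b p M / qf M.
Proof.
rewrite -(chu_vandermonde 0); apply: eq_bigr => k _.
have q0 n : qpochn 0 p n = 1.
  by rewrite /qpochn big1 // => i _; rewrite mul0r subr0.
by rewrite !mul0r !q0 !mulr1.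
Qed.

(** The free [c] will be a power of the base that moves the centre of the sum to its middle, so that
    bilateral exponents stay natural numbers. *)
Lemma qbinomial_homog b c M : c != 0 ->
  \sum_(k < M.+1) (- b) ^+ k * c ^+ (M - k) * p ^+ 'C(k, 2) /
    (qf k * qf (M - k)) =
  (\prod_(i < M) (c - b * p ^+ i)) / qf M.
Proof.
move=> c0.
have -> : \prod_(i < M) (c - b * p ^+ i) = c ^+ M * qpochn (b / c) p M.
  rewrite /qpochn -[M in c ^+ M]card_ord -prodr_const -big_split /=.
  by apply: eq_bigr => i _; field.
rewrite -mulrA -qbinomial_theorem mulr_sumr; apply: eq_bigr => -[k /= kM] _.
have -> : c ^+ M = c ^+ k * c ^+ (M - k) by rewrite -exprD subnKC.
rewrite -mulNr exprMn exprVn.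
by field; rewrite !qf_neq0 expf_neq0.
Qed.

(* Relative to p^e; the usual denominator (p^(e+1); p)_(n+r) is rescaled by the
   constant (p; p)_e. *)
Definition bailey_pair e alpha beta := forall n,
  beta n = \sum_(r < n.+1) alpha r / (qf (n - r) * qf (n + r + e)).

(** This is the step of the Bailey chain with one of its two parameters sent to infinity; sigma is a
    p / rho with a = p^e. After an exchange of sums, the inner sum over n = r + k is a
    Chu-Vandermonde sum. Writing (sigma; p)_N / (sigma; p)_r as (sigma p^r; p)_(N-r) avoids a
    denominator that could vanish. *)
Lemma bailey_lemma e alpha beta rho sigma N :
  bailey_pair e alpha beta -> rho * sigma = p ^+ e.+1 ->
  \sum_(n < N.+1) qpochn rho p n * (- sigma) ^+ n * p ^+ 'C(n, 2) *
     beta n / qf (N - n) =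
  \sum_(r < N.+1) qpochn rho p r * (- sigma) ^+ r * p ^+ 'C(r, 2) *
     qpochn (sigma * p ^+ r) p (N - r) * alpha r /
     (qf (N - r) * qf (N + r + e)).
Proof.
move=> ab rs.
pose X n := qpochn rho p n * (- sigma) ^+ n * p ^+ 'C(n, 2).
transitivity (\sum_(n < N.+1) \sum_(r < N.+1) (if (r <= n)%N then
   X n * (alpha r / (qf (n - r) * qf (n + r + e))) / qf (N - n) else 0)).
  apply: eq_bigr => -[n /= nN] _.
  rewrite ab mulr_sumr mulr_suml -/(X n) (big_ord_widen N.+1 (fun r =>
    X n * (alpha r / (qf (n - r) * qf (n + r + e))) / qf (N - n))) //.
  by rewrite big_mkcond.
rewrite exchange_big; apply: eq_bigr => -[r /= rN] _.
have rN' : (r <= N)%N by [].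
transitivity (\sum_(k < (N - r).+1) X (r + k)%N *
   (alpha r / (qf k * qf (r + k + r + e))) / qf (N - r - k)).
  rewrite -(big_mkord predT (fun n => if (r <= n)%N then
    X n * (alpha r / (qf (n - r) * qf (n + r + e))) / qf (N - n) else 0)).
  rewrite (big_cat_nat (n := r)) //=; last exact: leqW.
  rewrite big_nat big1 ?add0r; last first.
    by move=> i /andP[_ ir]; rewrite leqNgt ir.
  rewrite -{1}[r]add0n big_addn big_mkord subSn //.
  apply: eq_bigr => k _; rewrite leq_addl addnK addnC; congr (_ / qf _); lia.
(* With these parameters a b p^k = p^(2r+e+k+1), so the second symbol of the Chu-Vandermonde sum
   completes (p; p)_(2r+k+e) to (p; p)_(N+r+e). *)
set a := rho * p ^+ r; set b := sigma * p ^+ r.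
have abp k : a * b * p ^+ k = p * p ^+ (r + r + e + k).
  rewrite /a /b mulrACA rs -!exprD -exprS; congr (_ ^+ _); lia.
have := chu_vandermonde a b (N - r).
move/(congr1 (fun t => X r * alpha r / qf (N + r + e) * t)).
rewrite mulr_sumr => H.
transitivity (X r * alpha r / qf (N + r + e) *
  (qpochn b p (N - r) / qf (N - r))); last first.
  by rewrite /X; field; rewrite !qf_neq0.
rewrite -H; apply: eq_bigr => -[k /= kM] _.
rewrite abp.
have -> : qf (N + r + e) = qf (r + k + r + e) *
    qpochn (p * p ^+ (r + r + e + k)) p (N - r - k).
  have -> : (N + r + e = (r + r + e + k) + (N - r - k))%N by lia.
  by rewrite qpochnD; congr (qf _ * _); lia.
have -> : X (r + k)%N = X r * ((- b) ^+ k * p ^+ 'C(k, 2) * qpochn a p k).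
  rewrite /X /a /b qpochnD exprD bin2D !exprD -mulNr
    [(- sigma * p ^+ r) ^+ k]exprMn -exprM.
  by ring.
have h := qf_neq0 (N + r + e); move: h.
have -> : (N + r + e = (r + r + e + k) + (N - r - k))%N by lia.
rewrite qpochnD mulf_eq0 negb_or => /andP[_ h].
by field; rewrite !qf_neq0 h.
Qed.

End Base.
End FiniteQSeries.

(** * Folding finite sums about their centre *)

Section Fold.
Context {V : nmodType}.
Implicit Types f : nat -> V.

Lemma sum_ord_ends f n :
  \sum_(k < n.+2) f k = f 0%N + \sum_(k < n) f k.+1 + f n.+1.
Proof.
by rewrite big_ord_recr big_ord_recl; congr (_ + _ + _); apply: eq_bigr.
Qed.

(** Peeling off the two end terms, which form the pair of largest r, leaves the same kind of sum for
    f shifted by one. *)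
Lemma sum_fold_even f n :
  \sum_(k < (2 * n).+1) f k =
  \sum_(r < n.+1) (if r == 0%N :> nat then f n else f (n + r)%N + f (n - r)%N).
Proof.
elim: n f => [|n IH] f; first by rewrite !big_ord1.
have -> : (2 * n.+1 = (2 * n).+2)%N by lia.
rewrite sum_ord_ends [RHS]big_ord_recr /=.
rewrite (IH (f \o S)) /= subnn addrAC addrC; congr (_ + _).
  apply: eq_bigr => -[r /= rn] _; case: eqP => // _.
  by rewrite addSn subSn.
by rewrite addrC; congr (f _ + _); lia.
Qed.

Lemma sum_fold_odd f n :
  \sum_(k < (2 * n).+2) f k =
  \sum_(r < n.+1) (f (n.+1 + r)%N + f (n - r)%N).
Proof.
elim: n f => [|n IH] f; first by rewrite big_ord_recr !big_ord1 addrC.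
have -> : (2 * n.+1 = (2 * n).+2)%N by lia.
rewrite sum_ord_ends [RHS]big_ord_recr /=.
rewrite (IH (f \o S)) /= subnn addrAC addrC; congr (_ + _).
  by apply: eq_bigr => -[r /= rn] _; rewrite addSn subSn.
by rewrite addrC; congr (f _ + _); lia.
Qed.

End Fold.

(** * Unit Bailey pairs relative to 1 and to p *)

Section UnitBaileyPair.
Context {F : fieldType}.
Implicit Types (n r : nat).

Lemma signr_sub n r : (r <= n)%N -> (-1) ^+ (n - r) = (-1) ^+ n * (-1) ^+ r :> F.
Proof.
move=> rn; rewrite -{2}(subnK rn) exprD -mulrA -expr2 -exprM muln2 -mul2n.
by rewrite exprM sqrrN expr1n expr1n mulr1.
Qed.

Variable p : F.
Hypothesis p_root : forall i, 1 - p ^+ i.+1 != 0.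
Hypothesis p_neq0 : p != 0.
Local Notation qf := (qpochn p p).

(** For n > 0, expand the product of p^n - p^i over i < 2n. Up to the common factor [K], which comes
    from the term of index n, the terms of index n + r and n - r are the two halves 1 and p^r of
    alpha_r. *)
Lemma unit_bailey_pair0 :
  bailey_pair p 0 (fun r => (if r == 0%N then 1 else 1 + p ^+ r) *
                            (-1) ^+ r * p ^+ 'C(r, 2)) (fun n => (n == 0%N)%:R).
Proof.
move=> n; case: (posnP n) => [->|n_gt0].
  by rewrite big_ord1 /= !qpochn0 !expr0 !mulr1 divr1.
rewrite mulr0n.
(* In the q-binomial theorem below, the factor of index n vanishes. *)
pose K := (-1) ^+ n * p ^+ ('C(n, 2) + n * n).
have K0 : K != 0 by rewrite mulf_neq0 ?expf_neq0 // oppr_eq0 oner_eq0.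
apply: (mulfI K0); rewrite mulr0 mulr_sumr.
have c0 : p ^+ n != 0 by rewrite expf_neq0.
have := qbinomial_homog p p_root 1 _ (2 * n)%N c0.
have n2 : (n < 2 * n)%N by lia.
rewrite (bigD1 (Ordinal n2)) //= mul1r subrr !mul0r => binomial0.
apply: esym; apply: etrans binomial0.
rewrite (sum_fold_even (fun k => (-1) ^+ k * p ^+ n ^+ (2 * n - k) *
  p ^+ 'C(k, 2) / (qf k * qf (2 * n - k)))).
apply: eq_bigr => -[r /= rn] _; rewrite /K addn0.
case: eqP => [->|_].
  have -> : (2 * n - n = n)%N by lia.
  rewrite subn0 addn0 -exprM exprD.
  by field; rewrite qf_neq0.
have -> : (2 * n - (n + r) = n - r)%N by lia.
have -> : (2 * n - (n - r) = n + r)%N by lia.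
rewrite -!exprM.
have -> : (-1) ^+ n * p ^+ ('C(n, 2) + n * n) *
   ((1 + p ^+ r) * (-1) ^+ r * p ^+ 'C(r, 2) / (qf (n - r) * qf (n + r))) =
  (-1) ^+ n * (-1) ^+ r * p ^+ ('C(n, 2) + n * n + 'C(r, 2)) /
    (qf (n + r) * qf (n - r)) +
  (-1) ^+ n * (-1) ^+ r * p ^+ ('C(n, 2) + n * n + 'C(r, 2) + r) /
    (qf (n + r) * qf (n - r)).
  by rewrite !exprD; field; rewrite !qf_neq0.
rewrite signr_sub // [(-1) ^+ (n + r)]exprD.
have H := bin2D (n - r) r.
rewrite subnK // in H.
have d := double_bin2 r.
have -> : ('C(n, 2) + n * n + 'C(r, 2) = n * (n - r) + 'C(n + r, 2))%N.
  by rewrite bin2D; nia.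
have -> : (n * (n - r) + 'C(n + r, 2) + r = n * (n + r) + 'C(n - r, 2))%N.
  by rewrite bin2D; nia.
by rewrite !exprD; field; rewrite !qf_neq0.
Qed.

(** The same argument with the 2n + 1 factors p^(n+1) - p^i. The factor of index n + 1 exists and
    vanishes when n > 0, and the terms of index n + 1 + r and n - r give the two halves of 1 -
    p^(2r+1). *)
Lemma unit_bailey_pair1 :
  bailey_pair p 1 (fun r => (-1) ^+ r * p ^+ 'C(r, 2) * (1 - p ^+ (2 * r + 1)))
    (fun n => (n == 0%N)%:R).
Proof.
move=> n; case: (posnP n) => [->|n_gt0].
  rewrite big_ord1 /= qpochnS !qpochn0 !expr0 !mul1r !mulr1.
  by rewrite muln0 add0n expr1 divff // -[p]expr1.
rewrite mulr0n.
pose K := - (-1) ^+ n * p ^+ ('C(n.+1, 2) + n.+1 * n).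
have K0 : K != 0.
  by rewrite mulf_neq0 ?expf_neq0 // oppr_eq0 expf_neq0 // oppr_eq0 oner_eq0.
apply: (mulfI K0); rewrite mulr0 mulr_sumr.
have c0 : p ^+ n.+1 != 0 by rewrite expf_neq0.
have := qbinomial_homog p p_root 1 _ (2 * n).+1 c0.
have n2 : (n.+1 < (2 * n).+1)%N by lia.
rewrite (bigD1 (Ordinal n2)) //= mul1r subrr !mul0r => binomial0.
apply: esym; apply: etrans binomial0.
rewrite (sum_fold_odd (fun k => (-1) ^+ k * p ^+ n.+1 ^+ ((2 * n).+1 - k) *
  p ^+ 'C(k, 2) / (qf k * qf ((2 * n).+1 - k)))).
apply: eq_bigr => -[r /= rn] _; rewrite /K.
have -> : ((2 * n).+1 - (n.+1 + r) = n - r)%N by lia.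
have -> : ((2 * n).+1 - (n - r) = n.+1 + r)%N by lia.
have -> : (n + r + 1 = n.+1 + r)%N by lia.
rewrite -!exprM.
have -> : - (-1) ^+ n * p ^+ ('C(n.+1, 2) + n.+1 * n) *
   ((-1) ^+ r * p ^+ 'C(r, 2) * (1 - p ^+ (2 * r + 1)) /
     (qf (n - r) * qf (n.+1 + r))) =
  - ((-1) ^+ n * (-1) ^+ r) * p ^+ ('C(n.+1, 2) + n.+1 * n + 'C(r, 2)) /
    (qf (n.+1 + r) * qf (n - r)) +
  (-1) ^+ n * (-1) ^+ r * p ^+ ('C(n.+1, 2) + n.+1 * n + 'C(r, 2) + (2 * r + 1)) /
    (qf (n.+1 + r) * qf (n - r)).
  by rewrite !exprD; field; rewrite !qf_neq0.
rewrite signr_sub // [(-1) ^+ (n.+1 + r)]exprD [(-1) ^+ n.+1]exprS.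
have H := bin2D (n - r) r.+1.
rewrite addnS subnK // in H.
have d := double_bin2 r.
have d' := double_bin2 r.+1.
have -> : ('C(n.+1, 2) + n.+1 * n + 'C(r, 2) =
           n.+1 * (n - r) + 'C(n.+1 + r, 2))%N.
  by rewrite (bin2D n.+1 r); nia.
have -> : (n.+1 * (n - r) + 'C(n.+1 + r, 2) + (2 * r + 1) =
           n.+1 * (n.+1 + r) + 'C(n - r, 2))%N.
  by rewrite (bin2D n.+1 r); nia.
by rewrite !exprD; field; rewrite !qf_neq0.
Qed.

End UnitBaileyPair.

(** * First step of the chain: Bailey pairs with beta_n = 1 / (p^2; p^2)_n *)

Section GaussBaileyPair.
Context {F : fieldType}.
Implicit Types (q : F) (r N : nat).

(* The terms of sum_(r in Z) (-1)^r q^(3 r^2) and of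
   sum_(r in Z) (-1)^r q^(3 r^2 + 2 r), folded along r <-> - r and
   r <-> - r - 1. *)
Definition theta0 q r : F :=
  (if r == 0%N then 1 else 2) * (-1) ^+ r * q ^+ (3 * r ^ 2).
Definition theta1 q r : F :=
  (-1) ^+ r * q ^+ (3 * r ^ 2 + 2 * r) * (1 - q ^+ (2 * r + 1)).

Variable p : F.
Hypothesis p_root : forall i, 1 - p ^+ i.+1 != 0.
Hypothesis p_oppr : forall i, 1 - - p * p ^+ i != 0.
Hypothesis p_neq0 : p != 0.
Local Notation qf := (qpochn p p).
Local Notation gauss_beta :=
  (fun n => (qpochn p p n * qpochn (- p) p n)^-1).

Lemma sum_delta (f : nat -> F) N :
  \sum_(n < N.+1) f n * (n == 0%N :> nat)%:R = f 0%N.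
Proof.
rewrite big_ord_recl /= mulr1 big1 ?addr0 // => i _.
by rewrite mulr0.
Qed.

(** Take rho = -1 and sigma = -p on the unit pair: only n = 0 survives on the left, and dividing by
    (-p; p)_N gives beta_N. On the right, (-1; p)_r / (-p; p)_r = 2 / (1 + p^r) for r > 0 cancels
    the factor 1 + p^r and leaves the 2. *)
Lemma gauss_bailey_pair0 :
  bailey_pair p 0 (fun r => (if r == 0%N then 1 else 2) * (-1) ^+ r *
    p ^+ (r ^ 2)) gauss_beta.
Proof.
move=> N; have NN := qpochn_neq0 _ _ N p_oppr.
have /= := bailey_lemma p p_root 0 _ _ (-1) (- p) N
  (unit_bailey_pair0 p p_root p_neq0).
rewrite mulrNN mul1r expr1 => /(_ erefl).
pose f n := qpochn (-1) p n * (- - p) ^+ n * p ^+ 'C(n, 2) / qf (N - n).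
under eq_bigr => n _ do rewrite mulrAC -/(f n).
rewrite sum_delta /f subn0 qpochn0 !expr0 !mul1r => H.
rewrite invfM H mulr_suml; apply: eq_bigr => -[r /= rN] _.
rewrite opprK.
have -> : qpochn (- p) p N = qpochn (- p) p r * qpochn (- p * p ^+ r) p (N - r).
  by rewrite -qpochnD subnKC.
have : qpochn (- p) p N != 0 by [].
rewrite -(subnKC (rN : (r <= N)%N)) qpochnD mulf_eq0 negb_or => /andP[h1 h2].
have d := double_bin2 r; rewrite subnKC //.
case: eqP => [r0|].
  rewrite r0 expr0 mulr1 in h2 *.
  by rewrite !qpochn0 !expr0; field; rewrite !qf_neq0.
case: r rN h1 h2 d => // r rN h1 h2 d _.
rewrite qpochnSl mulN1r [qpochn (- p) p r.+1]qpochnS.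
rewrite qpochnS mulf_eq0 negb_or in h1; case/andP: h1 => h1 h3.
have -> : (r.+1 ^ 2 = r.+1 + 'C(r.+1, 2) + 'C(r.+1, 2))%N by lia.
rewrite !exprD !mulNr -!exprS opprK in h2 h3 *.
by field; rewrite !qf_neq0 // h1 h2 h3.
Qed.

(** Here rho = sigma = -p, and the symbols (-p; p)_r cancel completely. *)
Lemma gauss_bailey_pair1 :
  bailey_pair p 1 (fun r => (-1) ^+ r * p ^+ (r ^ 2) * (1 - p ^+ (2 * r + 1)))
    gauss_beta.
Proof.
move=> N; have NN := qpochn_neq0 _ _ N p_oppr.
have /= := bailey_lemma p p_root 1 _ _ (- p) (- p) N
  (unit_bailey_pair1 p p_root p_neq0).
rewrite mulrNN -expr2 => /(_ erefl).
pose f n := qpochn (- p) p n * (- - p) ^+ n * p ^+ 'C(n, 2) / qf (N - n).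
under eq_bigr => n _ do rewrite mulrAC -/(f n).
rewrite sum_delta /f subn0 qpochn0 !expr0 !mul1r => H.
rewrite invfM H mulr_suml; apply: eq_bigr => -[r /= rN] _.
rewrite opprK.
have -> : qpochn (- p) p N = qpochn (- p) p r * qpochn (- p * p ^+ r) p (N - r).
  by rewrite -qpochnD subnKC.
have : qpochn (- p) p N != 0 by [].
rewrite -(subnKC (rN : (r <= N)%N)) qpochnD mulf_eq0 negb_or => /andP[h1 h2].
have d := double_bin2 r; rewrite subnKC //.
have -> : (r ^ 2 = r + 'C(r, 2) + 'C(r, 2))%N by lia.
rewrite !exprD.
by field; rewrite !qf_neq0 // h1 h2.
Qed.

End GaussBaileyPair.

(** * Finite Slater identities and finite triple products *)

Section SlaterFinite.
Context {F : fieldType}.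
Variable q : F.
Hypothesis q_neq0 : q != 0.
Hypothesis one_sub_expr_neq0 : forall i, 1 - q ^+ i.+1 != 0.
Hypothesis one_add_expr_neq0 : forall i, 1 + q ^+ i.+1 != 0.
Implicit Types (n r N : nat).

Lemma one_sub_expr_expr_neq0 m : (0 < m)%N -> forall i, 1 - (q ^+ m) ^+ i.+1 != 0.
Proof. by case: m => // m _ i; rewrite -exprM mulnS addSn. Qed.

Lemma one_add_expr_expr_neq0 m : (0 < m)%N ->
  forall i, 1 - - (q ^+ m) * (q ^+ m) ^+ i != 0.
Proof. by case: m => // m _ i; rewrite mulNr opprK -exprS -exprM mulnS addSn. Qed.

Local Notation p := (q ^+ 2).
Local Notation qf := (qpochn p p).
Local Notation beta n := (qf n * qpochn (- p) p n)^-1.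

(** Second step of the chain, in base q^2 with rho = sigma = -q. The symbols on the right combine to
    (-q; q^2)_N for every r and come out of the sum. *)
Lemma finite_slater0 N :
  \sum_(n < N.+1) q ^+ (n ^ 2) * qpochn (- q) p n * beta n / qf (N - n) =
  qpochn (- q) p N * \sum_(r < N.+1) theta0 q r / (qf (N - r) * qf (N + r + 0)).
Proof.
have p_neq0 : p != 0 by rewrite expf_neq0.
have /= := bailey_lemma p (one_sub_expr_expr_neq0 2 isT) 0 _ _ (- q) (- q) N
  (gauss_bailey_pair0 p (one_sub_expr_expr_neq0 2 isT)
    (one_add_expr_expr_neq0 2 isT) p_neq0).
rewrite mulrNN -expr2 => /(_ erefl) H.
transitivity (\sum_(n < N.+1) qpochn (- q) p n * (- - q) ^+ n *
   p ^+ 'C(n, 2) * beta n / qf (N - n)).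
  apply: eq_bigr => -[n /= nN] _; rewrite opprK -exprM; congr (_ / _ / _).
  rewrite mulrC -mulrA -exprD; congr (_ * _ ^+ _).
  by have := double_bin2 n; lia.
rewrite H mulr_sumr; apply: eq_bigr => -[r /= rN] _.
have -> : qpochn (- q) p N = qpochn (- q) p r * qpochn (- q * p ^+ r) p (N - r).
  by rewrite -qpochnD subnKC.
rewrite opprK /theta0.
have e : (3 * r ^ 2 = r + 2 * 'C(r, 2) + 2 * r ^ 2)%N.
  by have := double_bin2 r; lia.
rewrite -!exprM [RHS]mulrA; congr (_ / _).
move: (2 * 'C(r, 2))%N (2 * r ^ 2)%N (3 * r ^ 2)%N e.
by move=> u v w ->; case: eqP => _; rewrite !exprD; ring.
Qed.

(** Here rho = -q and sigma = -q^3. In 1 - q^(4r+2) = (1 - q^(2r+1)) (1 + q^(2r+1)), the last factor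
    fills the gap between (-q; q^2)_r and (-q^(2r+3); q^2)_(N-r), giving (-q; q^2)_(N+1). *)
Lemma finite_slater1 N :
  \sum_(n < N.+1) q ^+ (n ^ 2 + 2 * n) * qpochn (- q) p n * beta n / qf (N - n) =
  qpochn (- q) p N.+1 *
  \sum_(r < N.+1) theta1 q r / (qf (N - r) * qf (N + r + 1)).
Proof.
have p_neq0 : p != 0 by rewrite expf_neq0.
have /= := bailey_lemma p (one_sub_expr_expr_neq0 2 isT) 1 _ _ (- q) (- q ^+ 3) N
  (gauss_bailey_pair1 p (one_sub_expr_expr_neq0 2 isT)
    (one_add_expr_expr_neq0 2 isT) p_neq0).
rewrite mulrNN -exprS -exprM => /(_ erefl) H.
transitivity (\sum_(n < N.+1) qpochn (- q) p n * (- - q ^+ 3) ^+ n *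
   p ^+ 'C(n, 2) * beta n / qf (N - n)).
  apply: eq_bigr => -[n /= nN] _; rewrite opprK -!exprM; congr (_ / _ / _).
  rewrite mulrC -mulrA -exprD; congr (_ * _ ^+ _).
  by have := double_bin2 n; lia.
rewrite H mulr_sumr; apply: eq_bigr => -[r /= rN] _.
have -> : qpochn (- q) p N.+1 =
    qpochn (- q) p r * ((1 + q * p ^+ r) * qpochn (- q ^+ 3 * p ^+ r) p (N - r)).
  have -> : - q ^+ 3 * p ^+ r = - q * p ^+ r * p by ring.
  have -> : 1 + q * p ^+ r = 1 - - q * p ^+ r by ring.
  by rewrite -qpochnSl -qpochnD; congr qpochn; lia.
rewrite opprK /theta1.
have -> : 1 - p ^+ (2 * r + 1) = (1 - q ^+ (2 * r + 1)) * (1 + q * p ^+ r).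
  rewrite -!exprM -exprS; have -> : (2 * (2 * r + 1) = (2 * r + 1) * 2)%N by lia.
  by rewrite exprM addn1; ring.
have e : (3 * r ^ 2 + 2 * r = 3 * r + 2 * 'C(r, 2) + 2 * r ^ 2)%N.
  by have := double_bin2 r; lia.
rewrite -!exprM [RHS]mulrA; congr (_ / _).
move: (2 * 'C(r, 2))%N (2 * r ^ 2)%N (3 * r)%N (3 * r ^ 2 + 2 * r)%N e.
by move=> u v w x ->; rewrite !exprD; ring.
Qed.

Local Notation P := (q ^+ 6).
Local Notation Pf := (qpochn P P).

Lemma prod_expr_nat n : \prod_(i < n) P ^+ i = P ^+ 'C(n, 2).
Proof. by rewrite prodrXr -(big_mkord predT id) bin2_sum. Qed.

(** A product of 2N factors c - P^i is cut in the middle. Each half gives (q^3; q^6)_N, the first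
    one after reversing its order. *)
Lemma finite_jacobi0 N :
  \sum_(r < N.+1) theta0 q r / (Pf (N - r) * Pf (N + r + 0)) =
  qpochn (q ^+ 3) P N ^+ 2 / Pf (2 * N).
Proof.
have P_neq0 : P != 0 by rewrite expf_neq0.
have P_root := one_sub_expr_expr_neq0 6 isT.
(* The truncated subtraction 2N - 1 in the exponent of [c] is faithful only for N > 0. *)
case: (posnP N) => [->|N_gt0].
  by rewrite big_ord1 /theta0 muln0 !qpochn0 !expr0 !mulr1 expr1n.
(* This c completes the squares of the exponents, centring them at k = N. *)
pose c := q ^+ (3 * (2 * N - 1)).
have c0 : c != 0 by rewrite expf_neq0.
pose K := (-1) ^+ N * P ^+ 'C(N, 2) * c ^+ N.
have K0 : K != 0 by rewrite !mulf_neq0 ?expf_neq0 // oppr_eq0 oner_eq0.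
apply: (mulfI K0).
have := qbinomial_homog P P_root 1 c (2 * N)%N c0.
have -> : \prod_(i < 2 * N) (c - 1 * P ^+ i) = K * qpochn (q ^+ 3) P N ^+ 2.
  have -> : (2 * N = N + N)%N by lia.
  rewrite big_split_ord /=.
  have -> : \prod_(i < N) (c - 1 * P ^+ i) =
      (-1) ^+ N * P ^+ 'C(N, 2) * qpochn (q ^+ 3) P N.
    rewrite -prod_expr_nat -[X in (-1) ^+ X]card_ord -prodr_const.
    rewrite /qpochn [\prod_(i < N) (1 - _)](reindex_inj rev_ord_inj) /=.
    rewrite -!big_split /=; apply: eq_bigr => -[i /= iN] _.
    have -> : c = P ^+ i * (q ^+ 3 * P ^+ (N - i.+1)).
      by rewrite /c -!exprM -!exprD; congr (_ ^+ _); lia.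
    by ring.
  have -> : \prod_(i < N) (c - 1 * P ^+ (N + i)) = c ^+ N * qpochn (q ^+ 3) P N.
    rewrite -[X in c ^+ X]card_ord -prodr_const /qpochn -big_split /=.
    apply: eq_bigr => -[i /= iN] _.
    have -> : P ^+ (N + i) = c * (q ^+ 3 * P ^+ i).
      by rewrite /c -!exprM -!exprD; congr (_ ^+ _); lia.
    by ring.
  by rewrite /K; ring.
rewrite -mulrA => H; rewrite -H {H} mulr_sumr.
rewrite (sum_fold_even (fun k => (-1) ^+ k * c ^+ (2 * N - k) *
  P ^+ 'C(k, 2) / (Pf k * Pf (2 * N - k)))).
apply: eq_bigr => -[r /= rN] _; rewrite /K /theta0 addn0.
case: eqP => [->|_].
  have -> : (2 * N - N = N)%N by lia.
  by rewrite subn0 addn0 muln0; field; rewrite qf_neq0.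
have -> : (2 * N - (N + r) = N - r)%N by lia.
have -> : (2 * N - (N - r) = N + r)%N by lia.
rewrite signr_sub // [(-1) ^+ (N + r)]exprD.
have d := double_bin2 r.
have H := bin2D (N - r) r.
rewrite subnK // in H.
have e1 : c ^+ (N - r) * P ^+ 'C(N + r, 2) =
    P ^+ 'C(N, 2) * c ^+ N * q ^+ (3 * r ^ 2).
  by rewrite /c -!exprM -!exprD; congr (_ ^+ _); rewrite bin2D; nia.
have e2 : c ^+ (N + r) * P ^+ 'C(N - r, 2) =
    P ^+ 'C(N, 2) * c ^+ N * q ^+ (3 * r ^ 2).
  by rewrite /c -!exprM -!exprD; congr (_ ^+ _); nia.
rewrite -[(-1) ^+ N * _ * c ^+ (N - r) * _]mulrA e1.
rewrite -[(-1) ^+ N * _ * c ^+ (N + r) * _]mulrA e2.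
by field; rewrite !qf_neq0.
Qed.

Lemma finite_jacobi1 N :
  \sum_(r < N.+1) theta1 q r / (Pf (N - r) * Pf (N + r + 1)) =
  qpochn q P N.+1 * qpochn (q ^+ 5) P N / Pf (2 * N + 1).
Proof.
have P_neq0 : P != 0 by rewrite expf_neq0.
have P_root := one_sub_expr_expr_neq0 6 isT.
(* The product of the factors c - q^2 P^i is cut after i = N. This [c] satisfies c = q^2 P^N q and
   q^2 P^(N+1) = c q^5, so the factors next to the cut produce 1 - q and 1 - q^5. *)
pose c := q ^+ (6 * N + 3).
have c0 : c != 0 by rewrite expf_neq0.
pose K := (- q ^+ 2) ^+ N.+1 * P ^+ 'C(N.+1, 2) * c ^+ N.
have K0 : K != 0 by rewrite !mulf_neq0 ?expf_neq0 // oppr_eq0 expf_neq0.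
apply: (mulfI K0).
have := qbinomial_homog P P_root (q ^+ 2) c (2 * N).+1 c0.
have -> : \prod_(i < (2 * N).+1) (c - q ^+ 2 * P ^+ i) =
    K * (qpochn q P N.+1 * qpochn (q ^+ 5) P N).
  have -> : ((2 * N).+1 = N.+1 + N)%N by lia.
  rewrite big_split_ord /=.
  have -> : \prod_(i < N.+1) (c - q ^+ 2 * P ^+ i) =
      (- q ^+ 2) ^+ N.+1 * P ^+ 'C(N.+1, 2) * qpochn q P N.+1.
    rewrite -prod_expr_nat -[X in (- q ^+ 2) ^+ X]card_ord -prodr_const.
    rewrite /qpochn [\prod_(i < N.+1) (1 - _)](reindex_inj rev_ord_inj) /=.
    rewrite -!big_split /=; apply: eq_bigr => -[i /= iN] _.
    have -> : c = q ^+ 2 * P ^+ i * (q * P ^+ (N.+1 - i.+1)).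
      by rewrite /c -!exprM -exprS -!exprD; congr (_ ^+ _); lia.
    by ring.
  have -> : \prod_(i < N) (c - q ^+ 2 * P ^+ (N.+1 + i)) =
      c ^+ N * qpochn (q ^+ 5) P N.
    rewrite -[X in c ^+ X]card_ord -prodr_const /qpochn -big_split /=.
    apply: eq_bigr => -[i /= iN] _.
    have -> : q ^+ 2 * P ^+ (N.+1 + i) = c * (q ^+ 5 * P ^+ i).
      by rewrite /c -!exprM -!exprD; congr (_ ^+ _); lia.
    by ring.
  by rewrite /K; ring.
move=> H; rewrite [RHS]mulrA addn1 -H {H} mulr_sumr.
rewrite (sum_fold_odd (fun k => (- q ^+ 2) ^+ k * c ^+ ((2 * N).+1 - k) *
  P ^+ 'C(k, 2) / (Pf k * Pf ((2 * N).+1 - k)))).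
apply: eq_bigr => -[r /= rN] _; rewrite /K /theta1.
have -> : ((2 * N).+1 - (N.+1 + r) = N - r)%N by lia.
have -> : ((2 * N).+1 - (N - r) = N.+1 + r)%N by lia.
have -> : (N + r + 1 = N.+1 + r)%N by lia.
have sq2 k : (- q ^+ 2) ^+ k = (-1) ^+ k * q ^+ (2 * k).
  by rewrite exprM -exprMn mulN1r.
rewrite !sq2 signr_sub // [(-1) ^+ (N.+1 + r)]exprD [(-1) ^+ N.+1]exprS.
have d := double_bin2 r.
have d' := double_bin2 r.+1.
have H := bin2D (N - r) r.+1.
rewrite addnS subnK // in H.
have e1 : q ^+ (2 * (N.+1 + r)) * c ^+ (N - r) * P ^+ 'C(N.+1 + r, 2) =
    q ^+ (2 * N.+1) * P ^+ 'C(N.+1, 2) * c ^+ N * q ^+ (3 * r ^ 2 + 2 * r).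
  by rewrite /c -!exprM -!exprD; congr (_ ^+ _); rewrite (bin2D N.+1 r); nia.
have e2 : q ^+ (2 * (N - r)) * c ^+ (N.+1 + r) * P ^+ 'C(N - r, 2) =
    q ^+ (2 * N.+1) * P ^+ 'C(N.+1, 2) * c ^+ N *
    (q ^+ (3 * r ^ 2 + 2 * r) * q ^+ (2 * r + 1)).
  by rewrite /c -!exprM -!exprD; congr (_ ^+ _); nia.
have -> : -1 * (-1) ^+ N * (-1) ^+ r * q ^+ (2 * (N.+1 + r)) * c ^+ (N - r) *
     P ^+ 'C(N.+1 + r, 2) = -1 * (-1) ^+ N * (-1) ^+ r *
   (q ^+ (2 * (N.+1 + r)) * c ^+ (N - r) * P ^+ 'C(N.+1 + r, 2)) by rewrite !mulrA.
have -> : (-1) ^+ N * (-1) ^+ r * q ^+ (2 * (N - r)) * c ^+ (N.+1 + r) *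
     P ^+ 'C(N - r, 2) = (-1) ^+ N * (-1) ^+ r *
   (q ^+ (2 * (N - r)) * c ^+ (N.+1 + r) * P ^+ 'C(N - r, 2)) by rewrite !mulrA.
by rewrite e1 e2; field; rewrite !qf_neq0.
Qed.

End SlaterFinite.

(** * Passage to the limit *)

(* The part of completeness that is needed; for R[i] it is inherited from R
   through real and imaginary parts. *)
Definition geometrically_complete (K : numFieldType) :=
  forall (u : nat -> K) (M s : K), 0 <= s -> s < 1 ->
  (forall n, `|u n.+1 - u n| <= M * s ^+ n) -> cvg (u @ \oo)%classic.

Section GeometricLimits.
Local Open Scope classical_set_scope.
Context {K : numFieldType}.
Hypothesis Kc : geometrically_complete K.
Implicit Types (a p s M B : K) (u v : nat -> K).

Lemma cvg0_le u v : v @ \oo --> 0 -> (forall n, `|u n| <= v n) ->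
  u @ \oo --> 0.
Proof.
move=> v0 uv; apply/cvgr0Pnorm_lt => eps eps0.
move/cvgr0Pnorm_lt: v0 => /(_ _ eps0); apply: filterS => n vn.
by apply: le_lt_trans vn; rewrite (le_trans (uv n)) // real_ler_norm ?ger0_real //
  (le_trans _ (uv n)).
Qed.

(** Over a general [numFieldType] there is no archimedean argument. Completeness supplies a limit l,
    and s l = l forces l = 0. *)
Lemma cvg_expr_lt1 s : 0 <= s -> s < 1 -> (fun n => s ^+ n) @ \oo --> 0.
Proof.
move=> s0 s1.
have /cvg_ex[l sl] : cvg ((fun n => s ^+ n) @ \oo).
  apply: (@Kc _ 1 s s0 s1) => n.
  rewrite exprS -{2}[s ^+ n]mul1r -mulrBl normrM (ger0_norm (exprn_ge0 _ s0)).
  rewrite ler_wpM2r ?exprn_ge0 // distrC ger0_norm ?gerBl //.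
  by rewrite subr_ge0 ltW.
have sl1 : (fun n => s * s ^+ n) @ \oo --> s * l by apply: cvgMl_tmp.
have sl2 : (fun n => s ^+ n.+1) @ \oo --> l.
  by rewrite (cvg_shiftS (fun n => s ^+ n)).
have /eqP : s * l = l.
  rewrite -(cvg_lim (@norm_hausdorff K K) sl1) -(cvg_lim (@norm_hausdorff K K) sl2).
  by under [in LHS]eq_fun do rewrite -exprS.
rewrite -[X in _ == X]mul1r -subr_eq0 -mulrBl mulf_eq0 subr_eq0 lt_eqF //=.
by move=> /eqP l0; rewrite l0 in sl.
Qed.

Lemma cvg0_geometric u M s : 0 <= s -> s < 1 ->
  (forall n, `|u n| <= M * s ^+ n) -> u @ \oo --> 0.
Proof.
move=> s0 s1; apply: cvg0_le.
by rewrite -[X in _ --> X](mulr0 M); apply: cvgMl_tmp; exact: cvg_expr_lt1.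
Qed.

Lemma exists_geometric_lt M s eps : 0 <= s -> s < 1 -> 0 <= M -> 0 < eps ->
  exists n, M * s ^+ n < eps.
Proof.
move=> s0 s1 M0 eps0.
have /cvgr0Pnorm_lt/(_ _ eps0) : (fun n => M * s ^+ n) @ \oo --> 0.
  apply: (cvg0_geometric _ M s) => // n.
  by rewrite ger0_norm // mulr_ge0 ?exprn_ge0.
case=> n _ /(_ n (leqnn n)) /= H; exists n.
by move: H; rewrite ger0_norm // mulr_ge0 ?exprn_ge0.
Qed.

(** An elementary bound without exponentials: past some index [n0], the product of m further factors
    stays below 2 - k s^m, by induction on m. *)
Lemma geometric_prod_bounded c s : 0 <= c -> 0 <= s -> s < 1 ->
  exists2 B, 0 < B & forall n, \prod_(i < n) (1 + c * s ^+ i) <= B.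
Proof.
move=> c0 s0 s1.
have s1' : 0 < 1 - s by rewrite subr_gt0.
have [n0 n0P] := exists_geometric_lt (2 * c) s (1 - s) s0 s1
  (mulr_ge0 (ler0n _ 2) c0) s1'.
pose d := c * s ^+ n0.
have d0 : 0 <= d by rewrite /d mulr_ge0 ?exprn_ge0.
(* Chosen so that k (1 - s) = 2 d: the induction step then has slack exactly k d s^(2m). The choice
   of [n0] makes k <= 1, which the empty product requires. *)
pose k := 2 * d / (1 - s).
have k0 : 0 <= k by rewrite /k divr_ge0 ?mulr_ge0 ?exprn_ge0 ?(ltW s1').
have k1 : k <= 1 by rewrite /k ler_pdivrMr // mul1r /d mulrA ltW.
have tail m : \prod_(i < m) (1 + d * s ^+ i) <= 2 - k * s ^+ m.
  elim: m => [|m IH].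
    by rewrite big_ord0 expr0 mulr1 lerBrDr -lerBrDl (_ : 2 - 1 = 1) //; ring.
  have sm : 0 <= s ^+ m by rewrite exprn_ge0.
  rewrite big_ord_recr /=.
  apply: (@le_trans _ _ ((2 - k * s ^+ m) * (1 + d * s ^+ m))).
    by rewrite ler_wpM2r // addr_ge0 // mulr_ge0.
  rewrite -subr_ge0.
  have -> : 2 - k * s ^+ m.+1 - (2 - k * s ^+ m) * (1 + d * s ^+ m) =
    (k * (1 - s) - 2 * d) * s ^+ m + k * d * s ^+ m * s ^+ m.
    by rewrite exprS; ring.
  have -> : k * (1 - s) = 2 * d by rewrite /k divfK ?gt_eqF.
  by rewrite subrr mul0r add0r; do 3?[apply: mulr_ge0 => //].
have le1 j m : 1 <= \prod_(i < m) (1 + c * s ^+ (j + i)).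
  elim/big_ind: _ => // [x y|i _]; first exact: mulr_ege1.
  by rewrite lerDl mulr_ge0 ?exprn_ge0.
exists (\prod_(i < n0) (1 + c * s ^+ i) * 2).
  by rewrite mulr_gt0 // (lt_le_trans ltr01) // (le1 0%N).
move=> n.
apply: (@le_trans _ _ (\prod_(i < n0 + n) (1 + c * s ^+ i))).
  rewrite addnC big_split_ord /= ler_peMr ?(le1 n) //.
  exact: le_trans ler01 (le1 0%N _).
rewrite big_split_ord /= ler_wpM2l //; first exact: le_trans ler01 (le1 0%N _).
under eq_bigr do rewrite exprD mulrA -/d.
by apply: le_trans (tail n) _; rewrite gerBl mulr_ge0 ?exprn_ge0.
Qed.

Lemma qpochn_bounded a p : `|p| < 1 ->
  exists2 B, 0 < B & forall n, `|qpochn a p n| <= B.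
Proof.
move=> p1.
have [B B0 HB] := geometric_prod_bounded `|a| `|p| (normr_ge0 _) (normr_ge0 _) p1.
exists B => // n; apply: le_trans (HB n).
rewrite normr_prod; apply: ler_prod => i _; rewrite normr_ge0 /=.
by rewrite (le_trans (ler_normB _ _)) // normr1 normrM normrX.
Qed.

Lemma cvg_qpochn a p : `|p| < 1 -> qpochn a p @ \oo --> qpoch a p.
Proof.
move=> p1; have [B B0 HB] := qpochn_bounded a p p1.
rewrite /qpoch; under eq_fun do rewrite big_mkord.
apply: (@Kc (qpochn a p) (B * `|a|) `|p|) => // n.
rewrite qpochnS mulrBr mulr1 addrAC subrr add0r normrN normrM -mulrA.
by rewrite normrM normrX ler_wpM2r ?mulr_ge0 ?exprn_ge0.
Qed.

Lemma qpochn_factor_neq0 a p : `|a| < 1 -> `|p| < 1 ->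
  forall i, 1 - a * p ^+ i != 0.
Proof.
move=> a1 p1 i; rewrite subr_eq0; apply/eqP => /(congr1 Num.norm).
rewrite normr1 normrM normrX => /eqP; rewrite gt_eqF //.
by rewrite (le_lt_trans _ a1) // ler_piMr // exprn_ile1 // ltW.
Qed.

(** With x = |a| |p|^i <= |a|, one has 1 / (1 - x) <= 1 + x / (1 - |a|), which reduces the claim to
    a product of the form 1 + c s^i. *)
Lemma qpochn_inv_bounded a p : `|a| < 1 -> `|p| < 1 ->
  exists2 B, 0 < B & forall n, `|(qpochn a p n)^-1| <= B.
Proof.
move=> a1 p1; have a1' : 0 < 1 - `|a| by rewrite subr_gt0.
have c0 : 0 <= `|a| / (1 - `|a|) by rewrite divr_ge0 // ltW.
have [B B0 HB] := geometric_prod_bounded _ `|p| c0 (normr_ge0 _) p1.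
exists B => // n; apply: le_trans (HB n).
rewrite normfV normr_prod -prodfV; apply: ler_prod => i _.
rewrite invr_ge0 normr_ge0 /=.
set x := `|a| * `|p| ^+ i.
have x0 : 0 <= x by rewrite mulr_ge0 ?exprn_ge0.
have xa : x <= `|a| by rewrite ler_piMr // exprn_ile1 // ltW.
have x1 : 0 < 1 - x by rewrite subr_gt0 (le_lt_trans xa).
have nx : 1 - x <= `|1 - a * p ^+ i|.
  by rewrite -[X in X - _]normr1 /x -normrX -normrM lerB_dist.
apply: (@le_trans _ _ (1 - x)^-1).
  by rewrite lef_pV2 // posrE // (lt_le_trans x1).
rewrite mulrAC -/x -[X in X <= _]mul1r ler_pdivrMr //.
rewrite -subr_ge0.
have -> : (1 + x / (1 - `|a|)) * (1 - x) - 1 = x * (`|a| - x) / (1 - `|a|).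
  by field; rewrite gt_eqF.
by rewrite divr_ge0 ?mulr_ge0 ?subr_ge0 // ltW.
Qed.

(** A bound B on the inverses keeps the partial products at least 1 / B away from 0. *)
Lemma qpoch_neq0 a p : `|a| < 1 -> `|p| < 1 -> qpoch a p != 0.
Proof.
move=> a1 p1; have [B B0 HB] := qpochn_inv_bounded a p a1 p1.
apply/eqP => H; have := cvg_qpochn a p p1; rewrite H.
have iB : 0 < B^-1 by rewrite invr_gt0.
move=> /cvgr0Pnorm_lt/(_ _ iB)[n _ /(_ n (leqnn n))] /=.
move=> /lt_geF/negbT/negP; apply.
have := HB n; rewrite normfV => h.
have q0 : 0 < `|qpochn a p n|.
  by rewrite normr_gt0 qpochn_neq0 //; exact: qpochn_factor_neq0.
by rewrite -[X in _ <= X]invrK lef_pV2 // posrE invr_gt0.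
Qed.

End GeometricLimits.

(** * Tannery's theorem *)

Section Tannery.
Local Open Scope classical_set_scope.
Context {K : numFieldType}.
Hypothesis Kc : geometrically_complete K.
Implicit Types (a p s M B : K) (u v : nat -> K).

Lemma cvg_series_geometric u M s : 0 <= s -> s < 1 ->
  (forall n, `|u n| <= M * s ^+ n) ->
  cvg ((fun N => \sum_(n < N.+1) u n) @ \oo).
Proof.
move=> s0 s1 uM; apply: (@Kc _ (M * s) s) => // n.
by rewrite big_ord_recr /= addrAC subrr add0r -mulrA -exprS.
Qed.

Lemma cvg_sum_ord0 m (e : nat -> nat -> K) (theta : nat -> K) :
  (forall r, e ^~ r @ \oo --> 0) ->
  (fun N => \sum_(r < m) theta r * e N r) @ \oo --> 0.
Proof.
move=> e0; elim: m => [|m IH].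
  by under eq_fun do rewrite big_ord0; exact: cvg_cst.
have -> : (fun N => \sum_(r < m.+1) theta r * e N r) =
  (fun N => \sum_(r < m) theta r * e N r + theta m * e N m).
  by apply/funext => N; rewrite big_ord_recr.
rewrite -[X in _ --> X](addr0 0); apply: cvgD => //.
by rewrite -[X in _ --> X](mulr0 (theta m)); apply: cvgMl_tmp.
Qed.

Lemma geometric_tail_le s m k : 0 <= s -> s < 1 ->
  \sum_(r < k) s ^+ (m + r) <= s ^+ m / (1 - s).
Proof.
move=> s0 s1; have s1' : 0 < 1 - s by rewrite subr_gt0.
rewrite ler_pdivlMr //.
have -> : (\sum_(r < k) s ^+ (m + r)) * (1 - s) = s ^+ m - s ^+ (m + k).
  elim: k => [|k IH]; first by rewrite big_ord0 mul0r addn0 subrr.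
  by rewrite big_ord_recr /= mulrDl IH addnS exprS; ring.
by rewrite gerBl exprn_ge0.
Qed.

(** Cut the sum at an m for which the geometric tail is below eps / 2; the first m terms tend to 0
    one by one. *)
Lemma tannery0 (e : nat -> nat -> K) (theta : nat -> K) M s B :
  0 <= s -> s < 1 -> 0 < B ->
  (forall r, `|theta r| <= M * s ^+ r) -> (forall N r, `|e N r| <= B) ->
  (forall r, e ^~ r @ \oo --> 0) ->
  (fun N => \sum_(r < N.+1) theta r * e N r) @ \oo --> 0.
Proof.
move=> s0 s1 B0 thetaM eB e0; apply/cvgr0Pnorm_lt => eps eps0.
have s1' : 0 < 1 - s by rewrite subr_gt0.
have M0 : 0 <= M by have := thetaM 0%N; rewrite expr0 mulr1; exact: le_trans.
have eps2 : 0 < eps / 2 by rewrite divr_gt0.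
have C0 : 0 <= M * B / (1 - s) by rewrite divr_ge0 ?mulr_ge0 // ltW.
have [m mP] := exists_geometric_lt Kc _ s _ s0 s1 C0 eps2.
have /cvgr0Pnorm_lt/(_ _ eps2) := cvg_sum_ord0 m e theta e0.
move=> -[N0 _ HN0]; exists (maxn N0 m) => // N /=.
rewrite geq_max => /andP[N0N mN].
have -> : N.+1 = (m + (N.+1 - m))%N by rewrite subnKC // leqW.
rewrite big_split_ord /= (splitr eps).
apply: le_lt_trans (ler_normD _ _) _; apply: ltr_leD; first exact: HN0.
apply: le_trans (ler_norm_sum _ _ _) _.
apply: (@le_trans _ _ (\sum_(r < N.+1 - m) M * B * s ^+ (m + r))).
  apply: ler_sum => r _; rewrite normrM.
  by rewrite [M * B * _]mulrAC ler_pM.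
rewrite -mulr_sumr; apply: le_trans (ltW mP).
rewrite [leRHS]mulrAC -[leRHS]mulrA ler_wpM2l ?mulr_ge0 ?(ltW B0) //.
exact: geometric_tail_le.
Qed.

Lemma tannery (w : nat -> nat -> K) (theta : nat -> K) (W T : K) M s B :
  0 <= s -> s < 1 ->
  (forall r, `|theta r| <= M * s ^+ r) -> (forall N r, `|w N r| <= B) ->
  (forall r, w ^~ r @ \oo --> W) ->
  (fun N => \sum_(r < N.+1) theta r) @ \oo --> T ->
  (fun N => \sum_(r < N.+1) theta r * w N r) @ \oo --> T * W.
Proof.
move=> s0 s1 thetaM wB wW thetaT.
have B0 : 0 <= B by exact: le_trans (wB 0%N 0%N).
have E : (fun N => \sum_(r < N.+1) theta r * (w N r - W)) @ \oo --> 0.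
  (* The summand 1 makes the bound strictly positive. *)
  apply: (tannery0 (fun N r => w N r - W) theta M s (B + `|W| + 1)) => //.
  - by rewrite ltr_wpDl // addr_ge0.
  - move=> N r; apply: (@le_trans _ _ (B + `|W|)); last by rewrite lerDl.
    by apply: le_trans (ler_normB _ _) _; rewrite lerD2r.
  - by move=> r; rewrite -(subrr W); apply: cvgB => //; exact: cvg_cst.
rewrite -[X in _ --> X](add0r (T * W)).
have -> : (fun N => \sum_(r < N.+1) theta r * w N r) =
  (fun N => \sum_(r < N.+1) theta r * (w N r - W) + (\sum_(r < N.+1) theta r) * W).
  apply/funext => N; rewrite mulr_suml -big_split; apply: eq_bigr => r _ /=.
  by rewrite mulrBr subrK.
by apply: cvgD => //; apply: cvgMr_tmp.
Qed.

Section Weights.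
Variable p : K.
Hypothesis p1 : `|p| < 1.
Local Notation pf := (qpochn p p).

Let pf_cvg := cvg_qpochn Kc p p p1.
Let pf_neq0 : qpoch p p != 0 := qpoch_neq0 Kc p p p1 p1.

Lemma cvg_qpochn_addn m : (fun N => pf (N + m)) @ \oo --> qpoch p p.
Proof. by rewrite (cvg_shiftn m pf). Qed.

Lemma cvg_qpochn_subn m : (fun N => pf (N - m)) @ \oo --> qpoch p p.
Proof. by rewrite (cvg_centern m pf). Qed.

(** The weights (p; p)_N / (p; p)_(N-r) tend to 1. This handles the beta side of the finite
    identities. *)
Lemma tannery_qpochn1 (theta : nat -> K) M s (T : K) :
  0 <= s -> s < 1 -> (forall r, `|theta r| <= M * s ^+ r) ->
  (fun N => \sum_(r < N.+1) theta r) @ \oo --> T ->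
  (fun N => pf N * \sum_(r < N.+1) theta r / pf (N - r)) @ \oo --> T.
Proof.
move=> s0 s1 thetaM thetaT.
have [B B0 HB] := qpochn_bounded Kc p p p1.
have [B' B'0 HB'] := qpochn_inv_bounded Kc p p p1 p1.
have -> : (fun N => pf N * \sum_(r < N.+1) theta r / pf (N - r)) =
  (fun N => \sum_(r < N.+1) theta r * (pf N * (pf (N - r))^-1)).
  apply/funext => N; rewrite mulr_sumr; apply: eq_bigr => r _.
  by rewrite mulrCA.
rewrite -[X in _ --> X]mulr1 -(divff pf_neq0).
apply: (tannery (fun N r => pf N / pf (N - r)) theta _ _ M s (B * B')) => // [N r|r].
  by rewrite normrM ler_pM.
by apply: cvgM => //; apply: cvgV => //; exact: cvg_qpochn_subn.
Qed.

(** For the alpha side: of the two denominators, one is cancelled in the limit and the other leaves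
    1 / (p; p)_oo. *)
Lemma tannery_qpochn2 e (theta : nat -> K) M s (T : K) :
  0 <= s -> s < 1 -> (forall r, `|theta r| <= M * s ^+ r) ->
  (fun N => \sum_(r < N.+1) theta r) @ \oo --> T ->
  (fun N => pf N * \sum_(r < N.+1) theta r / (pf (N - r) * pf (N + r + e)))
    @ \oo --> T / qpoch p p.
Proof.
move=> s0 s1 thetaM thetaT.
have [B B0 HB] := qpochn_bounded Kc p p p1.
have [B' B'0 HB'] := qpochn_inv_bounded Kc p p p1 p1.
have -> : (fun N => pf N * \sum_(r < N.+1) theta r / (pf (N - r) * pf (N + r + e))) =
  (fun N => \sum_(r < N.+1) theta r *
     (pf N * ((pf (N - r))^-1 * (pf (N + (r + e)))^-1))).
  apply/funext => N; rewrite mulr_sumr; apply: eq_bigr => r _.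
  by rewrite mulrCA invfM addnA.
have -> : (qpoch p p)^-1 = qpoch p p * ((qpoch p p)^-1 * (qpoch p p)^-1).
  by rewrite mulrA divff // mul1r.
apply: (tannery (fun N r => pf N * ((pf (N - r))^-1 * (pf (N + (r + e)))^-1))
  theta _ _ M s (B * (B' * B'))) => // [N r|r].
  by rewrite !normrM !ler_pM // mulr_ge0.
apply: cvgM => //; apply: cvgM; apply: cvgV => //.
  exact: cvg_qpochn_subn.
exact: cvg_qpochn_addn.
Qed.

End Weights.
End Tannery.

(** * Theta sums and the evaluation of F_0 and F_1 *)

Section ThetaLimits.
Local Open Scope classical_set_scope.
Context {K : numFieldType}.
Hypothesis Kc : geometrically_complete K.

Lemma cvg_inj (u : nat -> K) (l l' : K) :
  u @ \oo --> l -> u @ \oo --> l' -> l = l'.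
Proof.
by move=> /(cvg_lim (@norm_hausdorff K K)) <- /(cvg_lim (@norm_hausdorff K K)).
Qed.

Lemma cvg_double (u : nat -> K) (l : K) c :
  u @ \oo --> l -> (fun N => u (2 * N + c)%N) @ \oo --> l.
Proof.
move=> ul; apply: (cvg_comp (fun N => 2 * N + c)%N u) ul.
move=> A [N0 _ H]; exists N0 => // n /= N0n; apply: H => /=; lia.
Qed.

Variable q : K.
Hypothesis q_neq0 : q != 0.
Hypothesis q_lt1 : `|q| < 1.

Lemma norm_expr_lt1 m : (0 < m)%N -> `|q ^+ m| < 1.
Proof. by move=> m0; rewrite normrX exprn_ilt1 // -lt0n. Qed.

Lemma norm_expr_le m n : (m <= n)%N -> `|q ^+ n| <= `|q| ^+ m.
Proof. by move=> mn; rewrite normrX ler_wiXn2l // ltW. Qed.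

Lemma one_sub_expr_neq0 i : 1 - q ^+ i.+1 != 0.
Proof. by rewrite exprS; exact: qpochn_factor_neq0. Qed.

Lemma one_add_expr_neq0 i : 1 + q ^+ i.+1 != 0.
Proof.
have Nq1 : `|- q| < 1 by rewrite normrN.
by have := qpochn_factor_neq0 (- q) q Nq1 q_lt1 i; rewrite mulNr opprK -exprS.
Qed.

Lemma theta0_le r : `|theta0 q r| <= 2 * `|q| ^+ r.
Proof.
rewrite /theta0 !normrM normrX normrN1 expr1n mulr1.
apply: ler_pM => //; last by apply: norm_expr_le; nia.
by case: eqP => _; rewrite ?normr1 ?normr_nat ?ler1n // .
Qed.

Lemma theta1_le r : `|theta1 q r| <= 2 * `|q| ^+ r.
Proof.
rewrite /theta1 !normrM normrX normrN1 expr1n mul1r mulrC.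
apply: ler_pM => //; last by apply: norm_expr_le; nia.
apply: le_trans (ler_normB _ _) _; rewrite normr1 lerD2l.
by rewrite ltW // norm_expr_lt1 // addn1.
Qed.

Local Notation P := (q ^+ 6).

Let P1 : `|P| < 1. Proof. exact: norm_expr_lt1. Qed.
Let PP_neq0 : qpoch P P != 0. Proof. exact: qpoch_neq0. Qed.

(** Multiply the finite identity by (P; P)_N and compare limits: the left side tends to T / (P;
    P)_oo, where T is the theta sum, and the right side to X Y. *)
Lemma jacobi_cvg e (theta x y : nat -> K) (X Y : K) :
  (forall r, `|theta r| <= 2 * `|q| ^+ r) ->
  x @ \oo --> X -> y @ \oo --> Y ->
  (forall N, \sum_(r < N.+1) theta r /
      (qpochn P P (N - r) * qpochn P P (N + r + e)) =
    x N * y N / qpochn P P (2 * N + e)) ->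
  (fun N => \sum_(r < N.+1) theta r) @ \oo --> qpoch P P * (X * Y).
Proof.
move=> theta_le xX yY H.
have /cvg_ex[T sT] := cvg_series_geometric Kc _ _ _ (normr_ge0 q) q_lt1 theta_le.
have := tannery_qpochn2 Kc _ P1 e _ _ _ _ (normr_ge0 q) q_lt1 theta_le sT.
under eq_fun do rewrite H.
move=> l1.
have l2 : (fun N => qpochn P P N * (x N * y N / qpochn P P (2 * N + e))) @ \oo -->
   qpoch P P * (X * Y / qpoch P P).
  apply: cvgM; first exact: cvg_qpochn.
  apply: cvgM; first exact: cvgM.
  by apply: cvgV => //; apply: (cvg_double (qpochn P P)); exact: cvg_qpochn.
have := cvg_inj _ _ _ l1 l2; rewrite mulrA => /(mulIf _) <- //.
by rewrite invr_eq0.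
Qed.

Lemma theta0_cvg : (fun N => \sum_(r < N.+1) theta0 q r) @ \oo -->
  qpoch P P * (qpoch (q ^+ 3) P * qpoch (q ^+ 3) P).
Proof.
apply: (jacobi_cvg 0 _ (qpochn (q ^+ 3) P) (qpochn (q ^+ 3) P)).
- exact: theta0_le.
- exact: cvg_qpochn.
- exact: cvg_qpochn.
- by move=> N; rewrite finite_jacobi0 // ?addn0 ?expr2 //; exact: one_sub_expr_neq0.
Qed.

Lemma theta1_cvg : (fun N => \sum_(r < N.+1) theta1 q r) @ \oo -->
  qpoch P P * (qpoch q P * qpoch (q ^+ 5) P).
Proof.
apply: (jacobi_cvg 1 _ (fun N => qpochn q P N.+1) (qpochn (q ^+ 5) P)).
- exact: theta1_le.
- by rewrite (cvg_shiftS (qpochn q P)); exact: cvg_qpochn.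
- exact: cvg_qpochn.
- by move=> N; rewrite finite_jacobi1 //; exact: one_sub_expr_neq0.
Qed.

Local Notation p := (q ^+ 2).
Local Notation qf := (qpochn p p).

Let p1 : `|p| < 1. Proof. exact: norm_expr_lt1. Qed.
Let Np1 : `|- p| < 1. Proof. by rewrite normrN. Qed.

Definition tail_term k n : K :=
  q ^+ (n ^ 2 + 2 * k * n) * qpochn (- q) p n / (qf n * qpochn (- p) p (n + k./2)).

(** The bound is uniform in k, so that it bounds all the F_k at once. *)
Lemma tail_term_le : exists2 M, 0 <= M &
  forall k n, `|tail_term k n| <= M * `|q| ^+ n.
Proof.
have [B B0 HB] := qpochn_bounded Kc (- q) p p1.
have [B' B'0 HB'] := qpochn_inv_bounded Kc p p p1 p1.
have [D D0 HD] := qpochn_inv_bounded Kc (- p) p Np1 p1.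
exists (B * (B' * D)); first by rewrite !mulr_ge0 // ltW.
move=> k n; rewrite /tail_term invfM -mulrA mulrC normrM.
apply: ler_pM => //; last by apply: norm_expr_le; nia.
by rewrite !normrM !ler_pM // mulr_ge0.
Qed.

Definition tail_sum k : K := lim ((fun N => \sum_(n < N.+1) tail_term k n) @ \oo).

Lemma cvg_tail_sum k :
  (fun N => \sum_(n < N.+1) tail_term k n) @ \oo --> tail_sum k.
Proof.
have [M M0 HM] := tail_term_le.
exact: (cvg_series_geometric Kc _ M `|q|).
Qed.

Lemma tail_sum_bounded : exists B, forall k, `|tail_sum k| <= B.
Proof.
have [M M0 HM] := tail_term_le.
have q1' : 0 < 1 - `|q| by rewrite subr_gt0.
exists (1 + M / (1 - `|q|)) => k.
have := cvg_tail_sum k => /cvgrPdist_lt/(_ _ ltr01)[N _ /(_ N (leqnn N))] /= HN.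
rewrite -(subrK (\sum_(n < N.+1) tail_term k n) (tail_sum k)).
apply: le_trans (ler_normD _ _) _; apply: lerD; first exact: ltW.
apply: le_trans (ler_norm_sum _ _ _) _.
apply: (@le_trans _ _ (\sum_(n < N.+1) M * `|q| ^+ n)).
  by apply: ler_sum => n _.
rewrite -mulr_sumr ler_wpM2l //.
have := geometric_tail_le `|q| 0 N.+1 (normr_ge0 q) q_lt1.
by rewrite expr0 mul1r.
Qed.

(** Both sides of the finite identity, multiplied by (p; p)_N, have limits by Tannery's theorem: F_k
    on the left, X T / (p; p)_oo on the right. *)
Lemma slater_cvg k e (theta x : nat -> K) (X T : K) :
  (forall r, `|theta r| <= 2 * `|q| ^+ r) ->
  x @ \oo --> X -> (fun N => \sum_(r < N.+1) theta r) @ \oo --> T ->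
  (forall N, \sum_(n < N.+1) tail_term k n / qf (N - n) =
    x N * \sum_(r < N.+1) theta r / (qf (N - r) * qf (N + r + e))) ->
  tail_sum k = X / qpoch p p * T.
Proof.
move=> theta_le xX thetaT H.
have [M M0 HM] := tail_term_le.
have l1 := tannery_qpochn1 Kc _ p1 _ _ _ _ (normr_ge0 q) q_lt1 (HM k)
  (cvg_tail_sum k).
have l2 := tannery_qpochn2 Kc _ p1 e _ _ _ _ (normr_ge0 q) q_lt1 theta_le thetaT.
rewrite mulrAC -mulrA; apply: cvg_inj l1 _.
under eq_fun do rewrite H mulrCA.
exact: cvgM.
Qed.

Lemma tail_sum0 : tail_sum 0 = qpoch (- q) p / qpoch p p *
  (qpoch P P * (qpoch (q ^+ 3) P * qpoch (q ^+ 3) P)).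
Proof.
apply: (slater_cvg 0 0 (theta0 q) (qpochn (- q) p)).
- exact: theta0_le.
- exact: cvg_qpochn.
- exact: theta0_cvg.
move=> N; rewrite -finite_slater0 //;
  [|exact: one_sub_expr_neq0|exact: one_add_expr_neq0].
by apply: eq_bigr => n _; rewrite /tail_term muln0 mul0n !addn0.
Qed.

Lemma tail_sum1 : tail_sum 1 = qpoch (- q) p / qpoch p p *
  (qpoch P P * (qpoch q P * qpoch (q ^+ 5) P)).
Proof.
apply: (slater_cvg 1 1 (theta1 q) (fun N => qpochn (- q) p N.+1)).
- exact: theta1_le.
- by rewrite (cvg_shiftS (qpochn (- q) p)); exact: cvg_qpochn.
- exact: theta1_cvg.
move=> N; rewrite -finite_slater1 //;
  [|exact: one_sub_expr_neq0|exact: one_add_expr_neq0].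
by apply: eq_bigr => n _; rewrite /tail_term muln1 addn0.
Qed.

Lemma tail_sum1_neq0 : tail_sum 1 != 0.
Proof.
rewrite tail_sum1 !mulf_neq0 ?invr_neq0 // qpoch_neq0 ?normrN //.
exact: norm_expr_lt1.
Qed.

Lemma tail_sum_ratio : tail_sum 0 / tail_sum 1 =
  qpoch2 (q ^+ 3) (q ^+ 3) P / qpoch2 q (q ^+ 5) P.
Proof.
have := tail_sum1_neq0; rewrite tail_sum0 tail_sum1 /qpoch2.
rewrite !mulf_eq0 !negb_or => /andP[/andP[h1 h2] /andP[h3 /andP[h4 h5]]].
rewrite invr_eq0 in h2.
by field; rewrite h1 h2 h3 h4 h5.
Qed.

End ThetaLimits.

(** * Convergence of the continued fraction *)

Section ContinuedFraction.
Local Open Scope classical_set_scope.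
Context {K : numFieldType}.
Hypothesis Kc : geometrically_complete K.
Variables (a b : nat -> K).

(* Euler's continuant of the m entries b_k, ..., b_(k+m-1), so that the tail
   b_k + a_(k+1) / (... / b_(k+n)) is continuant k n.+1 / continuant k.+1 n. *)
Fixpoint continuant k m : K :=
  if m is m'.+1 then
    b k * continuant k.+1 m' +
    (if m' is m''.+1 then a k.+1 * continuant k.+2 m'' else 0)
  else 1.

Lemma continuantS k m : continuant k m.+2 =
  b k * continuant k.+1 m.+1 + a k.+1 * continuant k.+2 m.
Proof. by []. Qed.

(** The second conclusion strengthens the induction: numerator and denominator never vanish
    together, so a tail equal to 0 or to infinity is still read off correctly. *)
Lemma cfrac_tail_continuant k n : (forall k, a k.+1 != 0) ->
  cfrac_tail a b k n =
    (if continuant k.+1 n == 0 then None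
     else Some (continuant k n.+1 / continuant k.+1 n)) /\
  ((continuant k n.+1 != 0) || (continuant k.+1 n != 0)).
Proof.
move=> a0; elim: n k => [|n IH] k.
  by rewrite /= addr0 !mulr1 oner_eq0 divr1 orbT.
have [tailE H] := IH k.+1.
rewrite -[cfrac_tail a b k n.+1]/(sphere_add (b k)
  (sphere_div (a k.+1) (cfrac_tail a b k.+1 n))) tailE continuantS.
move: (continuant k.+1 n.+1) (continuant k.+2 n) H => X Y H.
(* If Y = 0, the inner tail is infinity, its quotient is 0 and the outer tail is b_k, in agreement
   with (b_k X + a_(k+1) Y) / X. *)
have [Y0|Y0] := eqVneq Y 0.
  rewrite Y0 eqxx orbF in H; rewrite /= (negbTE H) orbT; split => //.
  by rewrite Y0 mulr0 !addr0 mulfK.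
rewrite /sphere_div mulf_eq0 invr_eq0 (negbTE Y0) orbF.
have [X0|X0] := eqVneq X 0; split => //=.
- by rewrite X0 mulr0 add0r mulf_neq0.
- by congr Some; field; rewrite X0 Y0.
- by rewrite orbT.
Qed.

Variable F : nat -> K.
Hypothesis F_rec : forall k, F k = b k * F k.+1 + a k.+1 * F k.+2.

Lemma continuant_tail k m :
  F k = continuant k m.+1 * F (k + m).+1 +
        a (k + m).+1 * continuant k m * F (k + m).+2.
Proof.
(* Both hypotheses expand up to the same right end. For n = 0 the second one would involve a
   continuant of length -1, which is taken to be 0. *)
have step j n : F j.+1 = continuant j.+1 n.+1 * F (j + n).+2 +
      a (j + n).+2 * continuant j.+1 n * F (j + n).+3 -> 
    F j.+2 = continuant j.+2 n * F (j + n).+2 + 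
      a (j + n).+2 * (if n is n'.+1 then continuant j.+2 n' else 0) *
        F (j + n).+3 ->
    F j = continuant j n.+2 * F (j + n).+2 +
      a (j + n).+2 * continuant j n.+1 * F (j + n).+3.
  move=> e1 e2; rewrite F_rec e1 e2 continuantS.
  case: n {e1 e2} => [|n]; last by rewrite [continuant j n.+2]continuantS; ring.
  by rewrite /=; ring.
(* The recursion of continuants has order two, so two consecutive lengths are carried along, for all
   k. *)
suff H n : forall k, (F k = continuant k n.+1 * F (k + n).+1 +
    a (k + n).+1 * continuant k n * F (k + n).+2) /\
   (F k = continuant k n.+2 * F (k + n).+2 +
    a (k + n).+2 * continuant k n.+1 * F (k + n).+3) by have [] := H m k.
elim: n => [|n IH] {m}k.
  have H j : F j = continuant j 1 * F j.+1 + a j.+1 * continuant j 0 * F j.+2.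
    by rewrite F_rec /=; ring.
  rewrite addn0; split => //; have := step k 0%N; rewrite addn0; apply => //.
  by rewrite /=; ring.
split; first by have [_] := IH k; rewrite addnS.
have := step k n.+1; rewrite addnS; apply.
  by have [_] := IH k.+1; rewrite addSn.
by have [] := IH k.+2; rewrite !addSn.
Qed.

Variables (c s B : K).
Hypotheses (c0 : 0 <= c) (s0 : 0 <= s) (s1 : s < 1).
Hypothesis b_le : forall k, `|b k| <= 1 + c * s ^+ k.
Hypothesis a_le : forall k, `|a k.+1| <= c * s ^+ k.
Hypothesis F_le : forall k, `|F k| <= B.

(** The constant 2 c adds the bounds on b_k and a_(k+1). The shorter continuant obeys the same bound
    because every factor is at least 1. *)
Lemma continuant_le k m :
  `|continuant k m| <= \prod_(i < m) (1 + 2 * c * s ^+ (k + i)).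
Proof.
have fac j : 1 <= 1 + 2 * c * s ^+ j by rewrite lerDl !mulr_ge0 ?exprn_ge0.
have prod_ge0 j n : 0 <= \prod_(i < n) (1 + 2 * c * s ^+ (j + i)).
  by apply: prodr_ge0 => i _; apply: le_trans (fac _).
have prodSl j n : \prod_(i < n.+1) (1 + 2 * c * s ^+ (j + i)) =
    (1 + 2 * c * s ^+ j) * \prod_(i < n) (1 + 2 * c * s ^+ (j.+1 + i)).
  rewrite big_ord_recl addn0; congr (_ * _); apply: eq_bigr => i _.
  by rewrite lift0 addnS addSn.
suff H n : forall k,
   `|continuant k n| <= \prod_(i < n) (1 + 2 * c * s ^+ (k + i)) /\
   `|continuant k n.+1| <= \prod_(i < n.+1) (1 + 2 * c * s ^+ (k + i)).
  by have [] := H m k.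
elim: n => [|n IH] {m}k.
  rewrite big_ord0 big_ord1 /= normr1 addr0 mulr1 addn0; split => //.
  apply: le_trans (b_le k) _; rewrite lerD2l -mulrA mulr_natl mulr2n lerDl.
  by rewrite mulr_ge0 ?exprn_ge0.
split; first by have [] := IH k.
rewrite continuantS prodSl.
set Z := \prod_(i < n.+1) _.
have XZ : `|continuant k.+1 n.+1| <= Z by have [] := IH k.+1.
have YZ : `|continuant k.+2 n| <= Z.
  have [+ _] := IH k.+2; move/le_trans; apply.
  by rewrite /Z prodSl ler_peMl.
apply: le_trans (ler_normD _ _) _; rewrite !normrM.
have -> : (1 + 2 * c * s ^+ k) * Z = (1 + c * s ^+ k) * Z + c * s ^+ k * Z by ring.
by apply: lerD; apply: ler_pM.
Qed.

Lemma continuant_bounded : exists2 D, 0 < D & forall k m, `|continuant k m| <= D.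
Proof.
have c2 : 0 <= 2 * c by rewrite mulr_ge0.
have [D D0 HD] := geometric_prod_bounded Kc _ _ c2 s0 s1.
exists D => // k m; apply: le_trans (continuant_le k m) _.
apply: le_trans (HD m); apply: ler_prod => i _.
rewrite addr_ge0 ?mulr_ge0 ?exprn_ge0 //= lerD2l ler_wpM2l //.
by rewrite ler_wiXn2l ?leq_addl // ltW.
Qed.

Lemma cvg_continuant_tail k :
  (fun m => continuant k m.+1 * F (k + m).+1) @ \oo --> F k.
Proof.
have [D D0 HD] := continuant_bounded.
have B0 : 0 <= B by exact: le_trans (F_le 0%N).
apply: (@cvg_sub0 _ _ _ _ _ _ (fun=> F k)); last exact: cvg_cst.
apply: (cvg0_geometric Kc _ (c * D * B) s) => // m.
rewrite [X in `|X|](_ : _ = - (a (k + m).+1 * continuant k m * F (k + m).+2)).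
  rewrite normrN !normrM.
  have -> : c * D * B * s ^+ m = c * s ^+ m * D * B by ring.
  rewrite !ler_pM ?mulr_ge0 //.
  apply: le_trans (a_le _) _; rewrite ler_wpM2l //.
  by rewrite ler_wiXn2l ?leq_addl // ltW.
change (continuant k m.+1 * F (k + m).+1 - F k =
  - (a (k + m).+1 * continuant k m * F (k + m).+2)).
by rewrite [X in _ - X](continuant_tail k m); ring.
Qed.

Lemma cfrac_value_tails : (forall k, a k.+1 != 0) -> F 1%N != 0 ->
  cfrac_value a b (Some (F 0%N / F 1%N)).
Proof.
move=> a0 F1; split; first by case.
pose U n := continuant 0 n.+1 * F n.+1.
pose V n := continuant 1 n * F n.+1.
have UF : U @ \oo --> F 0%N by exact: (cvg_continuant_tail 0).
have VF : V @ \oo --> F 1%N.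
  by rewrite -(cvg_shiftS V); exact: (cvg_continuant_tail 1).
have UV : (fun n => U n / V n) @ \oo --> F 0%N / F 1%N.
  by apply: cvgM => //; exact: cvgV.
apply: (@cvg_trans _ ((Some (U n / V n) : one_point_compactification K)
  @[n --> \oo])); last first.
  apply: (cvg_comp (fun n => U n / V n) (Some : K -> one_point_compactification K)) UV _.
  exact: one_point_compactification_some_continuous.
(* Once V n is nonzero, the approximant is finite and F_(n+1) cancels from U n / V n. *)
have [N _ VN] := cvgr_neq0 _ VF F1.
apply: near_eq_cvg; exists N => // n /VN /=.
rewrite /V mulf_eq0 negb_or => /andP[C1 Fn].
have [tailE _] := cfrac_tail_continuant 0 n a0.
rewrite /cfrac_approx tailE.
rewrite (negbTE C1); congr Some.
by rewrite /U /V; field; rewrite C1 Fn.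
Qed.

End ContinuedFraction.

(** * The three-term recurrence of the series F_k *)

Section TailRecurrence.
Local Open Scope classical_set_scope.
Context {K : numFieldType}.
Hypothesis Kc : geometrically_complete K.
Variable q : K.
Hypothesis q_neq0 : q != 0.
Hypothesis q_lt1 : `|q| < 1.
Local Notation p := (q ^+ 2).
Local Notation qf := (qpochn p p).

(** The telescoping behind the recurrence: each side is a combination of series, and their terms
    agree after a shift of the index by one. *)
Lemma lim_sum_shift (f g : nat -> K) (G H : K) :
  f 0%N = 0 -> (forall n, f n.+1 = g n) ->
  (fun N => \sum_(n < N.+1) f n) @ \oo --> G ->
  (fun N => \sum_(n < N.+1) g n) @ \oo --> H -> G = H.
Proof.
move=> f0 fg fG; apply: cvg_inj.
rewrite -(cvg_shiftS (fun N => \sum_(n < N.+1) f n)) in fG.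
have -> : (fun N => \sum_(n < N.+1) g n) =
    (fun N => \sum_(n < N.+2) f n); last exact: fG.
apply/funext => N; rewrite [RHS]big_ord_recl f0 add0r.
by apply: eq_bigr => n _; rewrite lift0 fg.
Qed.

Lemma cvg_sum_lin2 (f g : nat -> K) (F G x y : K) :
  (fun N => \sum_(n < N.+1) f n) @ \oo --> F ->
  (fun N => \sum_(n < N.+1) g n) @ \oo --> G ->
  (fun N => \sum_(n < N.+1) (x * f n + y * g n)) @ \oo --> x * F + y * G.
Proof.
move=> fF gG.
have -> : (fun N => \sum_(n < N.+1) (x * f n + y * g n)) =
  (fun N => x * (\sum_(n < N.+1) f n) + y * (\sum_(n < N.+1) g n)).
  by apply/funext => N; rewrite big_split !mulr_sumr.
by apply: cvgD; apply: cvgMl_tmp.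
Qed.

Let pf_neq0 n : qf n != 0.
Proof.
by apply: qf_neq0 => i; apply: one_sub_expr_expr_neq0 => //; exact: one_sub_expr_neq0.
Qed.

Let p_fac i : 1 - p * p ^+ i != 0.
Proof. by apply: qpochn_factor_neq0; rewrite norm_expr_lt1. Qed.

Let Np_fac i : 1 - - p * p ^+ i != 0.
Proof. by apply: qpochn_factor_neq0; rewrite ?normrN norm_expr_lt1. Qed.

Let Npf_neq0 n : qpochn (- p) p n != 0.
Proof. exact: qpochn_neq0. Qed.

(** The shift applies to F_(2m) - F_(2m+1): its term of index 0 vanishes because 2m and 2m + 1 have
    the same half. *)
Lemma tail_sum_even m : tail_sum q (2 * m) =
  (1 + q ^+ (4 * m + 1)) * tail_sum q (2 * m).+1 +
  (q ^+ (4 * m + 2) - q ^+ (6 * m + 3)) * tail_sum q (2 * m).+2.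
Proof.
rewrite mulrDl mul1r -addrA; apply/eqP; rewrite addrC -subr_eq; apply/eqP.
pose f := tail_term q.
apply: (lim_sum_shift (fun n => 1 * f (2 * m)%N n + (- 1) * f (2 * m).+1 n)
  (fun n => q ^+ (4 * m + 1) * f (2 * m).+1 n +
     (q ^+ (4 * m + 2) - q ^+ (6 * m + 3)) * f (2 * m).+2 n)).
- rewrite /f /tail_term !muln0 !addn0 !add0n.
  have -> : (2 * m)./2 = m by lia.
  have -> : (2 * m).+1./2 = m by lia.
  by ring.
- move=> n; rewrite /f /tail_term.
  have -> : (2 * m)./2 = m by lia.
  have -> : (2 * m).+1./2 = m by lia.
  have -> : (2 * m).+2./2 = m.+1 by lia.
  have -> : (n.+1 + m = (n + m).+1)%N by lia.
  have -> : (n + m.+1 = (n + m).+1)%N by lia.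
  rewrite !qpochnS.
  have h1 := p_fac n; have h2 := Np_fac (n + m).
  (* Factoring all powers over a few common monomials turns the equality of terms into a rational
     identity for [field]. *)
  have e1 : q ^+ (n.+1 ^ 2 + 2 * (2 * m) * n.+1) =
      q ^+ (n ^ 2 + 4 * m * n) * (q ^+ (4 * m + 1) * p ^+ n).
    by rewrite -exprM -!exprD; congr (_ ^+ _); lia.
  have e2 : q ^+ (n.+1 ^ 2 + 2 * (2 * m).+1 * n.+1) =
      q ^+ (n ^ 2 + 4 * m * n) * (q ^+ (4 * m + 1) * p ^+ n * (p * p ^+ n)).
    by rewrite -exprS -!exprM -!exprD; congr (_ ^+ _); lia.
  have e3 : q ^+ (n ^ 2 + 2 * (2 * m).+1 * n) = q ^+ (n ^ 2 + 4 * m * n) * p ^+ n.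
    by rewrite -exprM -!exprD; congr (_ ^+ _); lia.
  have e4 : q ^+ (n ^ 2 + 2 * (2 * m).+2 * n) =
      q ^+ (n ^ 2 + 4 * m * n) * (p ^+ n * p ^+ n).
    by rewrite -exprM -!exprD; congr (_ ^+ _); lia.
  have e5 : q ^+ (4 * m + 2) = q ^+ (4 * m + 1) * q.
    by rewrite -exprSr; congr (_ ^+ _); lia.
  have e6 : q ^+ (6 * m + 3) = q ^+ (4 * m + 1) * p * p ^+ m.
    by rewrite -exprM -!exprD; congr (_ ^+ _); lia.
  rewrite e1 e2 e3 e4 e5 e6 [p ^+ (n + m)]exprD in h2 *.
  move: (q ^+ (n ^ 2 + 4 * m * n)) (q ^+ (4 * m + 1)) => E x.
  by field; rewrite !pf_neq0 !Npf_neq0 h1 h2.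
- have -> : tail_sum q (2 * m) - tail_sum q (2 * m).+1 =
    1 * tail_sum q (2 * m) + (- 1) * tail_sum q (2 * m).+1 by ring.
  by apply: (cvg_sum_lin2 (f (2 * m)%N) (f (2 * m).+1)); exact: cvg_tail_sum.
- by apply: (cvg_sum_lin2 (f (2 * m).+1) (f (2 * m).+2)); exact: cvg_tail_sum.
Qed.

(** The half jumps from m to m + 1, so q^(2m+2) F_(2m+3) is moved to the left: at index 0, 1 +
    q^(2m+2) cancels the last factor of (-p; p)_(m+1). *)
Lemma tail_sum_odd m : tail_sum q (2 * m).+1 =
  (1 + q ^+ (4 * m + 3)) * tail_sum q (2 * m).+2 +
  (q ^+ (2 * m + 2) + q ^+ (4 * m + 4)) * tail_sum q (2 * m).+3.
Proof.
apply/eqP; rewrite -subr_eq0.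
have -> : tail_sum q (2 * m).+1 -
   ((1 + q ^+ (4 * m + 3)) * tail_sum q (2 * m).+2 +
    (q ^+ (2 * m + 2) + q ^+ (4 * m + 4)) * tail_sum q (2 * m).+3) =
   (1 * tail_sum q (2 * m).+1 + (- 1) *
     (1 * tail_sum q (2 * m).+2 + q ^+ (2 * m + 2) * tail_sum q (2 * m).+3)) -
   (q ^+ (4 * m + 3) * tail_sum q (2 * m).+2 +
    q ^+ (4 * m + 4) * tail_sum q (2 * m).+3) by ring.
rewrite subr_eq0; apply/eqP.
pose f := tail_term q.
apply: (lim_sum_shift (fun n => 1 * f (2 * m).+1 n + (- 1) *
    (1 * f (2 * m).+2 n + q ^+ (2 * m + 2) * f (2 * m).+3 n))
  (fun n => q ^+ (4 * m + 3) * f (2 * m).+2 n +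
     q ^+ (4 * m + 4) * f (2 * m).+3 n)).
- rewrite /f /tail_term !muln0 !addn0 !add0n.
  have -> : (2 * m).+1./2 = m by lia.
  have -> : (2 * m).+2./2 = m.+1 by lia.
  have -> : (2 * m).+3./2 = m.+1 by lia.
  have h2 := Np_fac m.
  rewrite !qpochn0 qpochnS expr0.
  have e : q ^+ (2 * m + 2) = p * p ^+ m.
    by rewrite -exprM -!exprD; congr (_ ^+ _); lia.
  by rewrite e; field; rewrite Npf_neq0 h2.
- move=> n; rewrite /f /tail_term.
  have -> : (2 * m).+1./2 = m by lia.
  have -> : (2 * m).+2./2 = m.+1 by lia.
  have -> : (2 * m).+3./2 = m.+1 by lia.
  have -> : (n.+1 + m.+1 = (n + m).+2)%N by lia.
  have -> : (n.+1 + m = (n + m).+1)%N by lia.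
  have -> : (n + m.+1 = (n + m).+1)%N by lia.
  rewrite !qpochnS.
  have h1 := p_fac n; have h2 := Np_fac (n + m).
  have h3 := Np_fac (n + m).+1.
  have e1 : q ^+ (n.+1 ^ 2 + 2 * (2 * m).+1 * n.+1) =
      q ^+ (n ^ 2 + 4 * m * n) * (q ^+ (4 * m + 3) * p ^+ n * p ^+ n).
    by rewrite -exprM -!exprD; congr (_ ^+ _); lia.
  have e2 : q ^+ (n.+1 ^ 2 + 2 * (2 * m).+2 * n.+1) =
      q ^+ (n ^ 2 + 4 * m * n) *
      (q ^+ (4 * m + 3) * p ^+ n * p ^+ n * (p * p ^+ n)).
    by rewrite -exprS -!exprM -!exprD; congr (_ ^+ _); lia.
  have e2' : q ^+ (n.+1 ^ 2 + 2 * (2 * m).+3 * n.+1) =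
      q ^+ (n ^ 2 + 4 * m * n) *
      (q ^+ (4 * m + 3) * p ^+ n * p ^+ n * (p * p ^+ n) * (p * p ^+ n)).
    by rewrite -exprS -!exprM -!exprD; congr (_ ^+ _); lia.
  have e3 : q ^+ (n ^ 2 + 2 * (2 * m).+2 * n) =
      q ^+ (n ^ 2 + 4 * m * n) * (p ^+ n * p ^+ n).
    by rewrite -exprM -!exprD; congr (_ ^+ _); lia.
  have e4 : q ^+ (n ^ 2 + 2 * (2 * m).+3 * n) =
      q ^+ (n ^ 2 + 4 * m * n) * (p ^+ n * p ^+ n * p ^+ n).
    by rewrite -exprM -!exprD; congr (_ ^+ _); lia.
  have e5 : q ^+ (4 * m + 4) = q ^+ (4 * m + 3) * q.
    by rewrite -exprSr; congr (_ ^+ _); lia.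
  have e6 : q ^+ (2 * m + 2) = p * p ^+ m.
    by rewrite -exprM -!exprD; congr (_ ^+ _); lia.
  rewrite e1 e2 e2' e3 e4 e5 e6.
  rewrite [p ^+ (n + m).+1]exprS [p ^+ (n + m)]exprD in h2 h3 *.
  move: (q ^+ (n ^ 2 + 4 * m * n)) (q ^+ (4 * m + 3)) => E x.
  by field; rewrite !pf_neq0 !Npf_neq0 h1 h2 h3.
- apply: (cvg_sum_lin2 (f (2 * m).+1)
    (fun n => 1 * f (2 * m).+2 n + q ^+ (2 * m + 2) * f (2 * m).+3 n)).
    exact: cvg_tail_sum.
  by apply: (cvg_sum_lin2 (f (2 * m).+2) (f (2 * m).+3)); exact: cvg_tail_sum.
- by apply: (cvg_sum_lin2 (f (2 * m).+2) (f (2 * m).+3)); exact: cvg_tail_sum.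
Qed.

End TailRecurrence.

(** * Geometric completeness of the real and complex numbers *)

Lemma real_geometrically_complete (R : realType) (v : nat -> R) (M s : R) :
  0 <= s -> s < 1 -> (forall n, `|v n.+1 - v n| <= M * s ^+ n) ->
  cvg (v @ \oo)%classic.
Proof.
move=> s0 s1 vM.
have M0 : 0 <= M by have := vM 0%N; rewrite expr0 mulr1; exact: le_trans.
have -> : v = (fun n => v 0%N + series (telescope v) n).
  by apply/funext => n; exact: eq_sum_telescope.
apply: is_cvgD; first exact: is_cvg_cst.
apply: normed_cvg.
apply: (@series_le_cvg _ _ (geometric M s)) => [n|n|n|] //=.
- by rewrite mulr_ge0 ?exprn_ge0.
- exact: vM.
- by apply: is_cvg_geometric_series; rewrite ger0_norm.
Qed.

Lemma normc_ge_Im (R : rcfType) (z : R[i]) : (`|complex.Im z|%:C)%C <= `|z|.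
Proof.
by rewrite normc_def lecR -sqrtr_sqr ler_wsqrtr // lerDr sqr_ge0.
Qed.

Lemma normc_le_ReDIm (R : rcfType) (z : R[i]) :
  `|z| <= ((`|complex.Re z| + `|complex.Im z|)%:C)%C.
Proof.
have s0 : 0 <= `|complex.Re z| + `|complex.Im z| by rewrite addr_ge0.
rewrite normc_def lecR -[leRHS]ger0_norm // -[leRHS]sqrtr_sqr ler_wsqrtr //.
rewrite sqrrD !real_normK ?num_real // addrAC lerDl.
by rewrite mulrn_wge0 // mulr_ge0.
Qed.

Lemma complex_geometrically_complete (R : realType) :
  geometrically_complete R[i].
Proof.
move=> u M s s0 s1 uM.
have M0 : 0 <= M by have := uM 0%N; rewrite expr0 mulr1; exact: le_trans.
(* In the order of R[i], being comparable with 0 means being real, so both constants of the bound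
   are real. *)
have Es : s = ((complex.Re s)%:C)%C by rewrite RRe_real // ger0_real.
have EM : M = ((complex.Re M)%:C)%C by rewrite RRe_real // ger0_real.
have s0' : 0 <= complex.Re s by move: s0; rewrite lecE => /andP[].
have s1' : complex.Re s < 1 by move: s1; rewrite ltcE => /andP[].
have le_part n : (`|u n.+1 - u n| <= (complex.Re M * complex.Re s ^+ n)%:C)%C.
  by rewrite rmorphM rmorphXn /= -Es -EM.
have Re_cvg : cvg ((fun n => complex.Re (u n)) @ \oo)%classic.
  apply: (real_geometrically_complete _ _ _ _ s0' s1') => n.
  rewrite -lecR; apply: le_trans (le_part n); apply: le_trans (normc_ge_Re _).
  by case: (u n.+1) (u n) => [x y] [z t].
have Im_cvg : cvg ((fun n => complex.Im (u n)) @ \oo)%classic.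
  apply: (real_geometrically_complete _ _ _ _ s0' s1') => n.
  rewrite -lecR; apply: le_trans (le_part n).
  apply: le_trans (normc_ge_Im _ _).
  by case: (u n.+1) (u n) => [x y] [z t].
move/cvg_ex: Re_cvg => [x ux]; move/cvg_ex: Im_cvg => [y uy].
pose K : numFieldType := R[i].
apply/(@cvg_ex K); exists (Complex x y).
apply/(@cvgrPdist_lt K K) => eps eps0.
have Eeps : eps = ((complex.Re eps)%:C)%C by rewrite RRe_real // gtr0_real.
have eps0' : 0 < complex.Re eps / 2.
  by rewrite divr_gt0 //; move: eps0; rewrite ltcE => /andP[].
move/cvgrPdist_lt/(_ _ eps0') : ux => [N1 _ H1].
move/cvgrPdist_lt/(_ _ eps0') : uy => [N2 _ H2].
exists (maxn N1 N2) => // n /=; rewrite geq_max => /andP[/H1 /= h1 /H2 /= h2].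
apply: le_lt_trans (normc_le_ReDIm _ _) _.
rewrite Eeps ltcR (splitr (complex.Re eps)).
by apply: ltrD; [move: h1|move: h2]; case: (u n).
Qed.

Theorem corollary2p4 (R : realType) (q : R[i]) (q_neq0 : q != 0)
  (q_lt1 : `|q| < 1) (a b : nat -> R[i])
  (b_def : forall k : nat, b k = 1 + q ^+ (2 * k + 1))
  (a_odd : forall n : nat, (1 <= n)%N ->
     a (2 * n - 1)%N = q ^+ (4 * n - 2) - q ^+ (6 * n - 3))
  (a_even : forall n : nat, (1 <= n)%N ->
     a (2 * n)%N = q ^+ (2 * n) + q ^+ (4 * n)) :
  cfrac_value a b
    (Some (qpoch2 (q ^+ 3) (q ^+ 3) (q ^+ 6) / qpoch2 q (q ^+ 5) (q ^+ 6))).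
Proof.
have Kc := complex_geometrically_complete R.
have [B HB] := tail_sum_bounded Kc q q_neq0 q_lt1.
have a1 m : a (2 * m).+1 = q ^+ (4 * m + 2) - q ^+ (6 * m + 3).
  have := a_odd m.+1 isT; have -> : (2 * m.+1 - 1 = (2 * m).+1)%N by lia.
  by move=> ->; congr (_ ^+ _ - _ ^+ _); lia.
have a2 m : a (2 * m).+2 = q ^+ (2 * m + 2) + q ^+ (4 * m + 4).
  have := a_even m.+1 isT; have -> : (2 * m.+1 = (2 * m).+2)%N by lia.
  by move=> ->; congr (_ ^+ _ + _ ^+ _); lia.
have parity k : k = (2 * k./2)%N \/ k = (2 * k./2).+1 by lia.
rewrite -(tail_sum_ratio Kc q q_neq0 q_lt1).
(* The constant 2 counts the two powers of q in a_(k+1), both with exponent at least k. *)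
apply: (cfrac_value_tails Kc _ _ _ _ 2 `|q| B) => //.
- move=> k; rewrite b_def; case: (parity k) => ->; move: (k./2) => m.
    by rewrite a1 (tail_sum_even Kc) //; congr ((1 + _ ^+ _) * _ + _); lia.
  by rewrite a2 (tail_sum_odd Kc) //; congr ((1 + _ ^+ _) * _ + _); lia.
- move=> k; rewrite b_def; apply: le_trans (ler_normD _ _) _.
  rewrite normr1 lerD2l; apply: (@le_trans _ _ (`|q| ^+ k)).
    by apply: norm_expr_le => //; lia.
  by rewrite ler_peMl ?exprn_ge0 // ler1n.
- move=> k.
  have le2 i j : (k <= i)%N -> (k <= j)%N ->
      `|q ^+ i| + `|q ^+ j| <= 2 * `|q| ^+ k.
    by move=> ki kj; rewrite mulr_natl mulr2n lerD // norm_expr_le.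
  case: (parity k) le2 => ->; move: (k./2) => m le2.
    by rewrite a1; apply: le_trans (ler_normB _ _) _; apply: le2; lia.
  by rewrite a2; apply: le_trans (ler_normD _ _) _; apply: le2; lia.
- move=> k; case: (parity k) => ->; move: (k./2) => m.
    have -> : a (2 * m).+1 = q ^+ (4 * m + 2) * (1 - q ^+ (2 * m).+1).
      by rewrite a1 mulrBr mulr1 -exprD; congr (_ - _ ^+ _); lia.
    by rewrite mulf_neq0 ?expf_neq0 // one_sub_expr_neq0.
  have -> : a (2 * m).+2 = q ^+ (2 * m + 2) * (1 + q ^+ (2 * m).+2).
    by rewrite a2 mulrDr mulr1 -exprD; congr (_ + _ ^+ _); lia.
  by rewrite mulf_neq0 ?expf_neq0 // one_add_expr_neq0.
- exact: tail_sum1_neq0.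
Qed.
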